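(* Let $\mathbf{\Lambda}$ be a rank-$3$ lattice group on $\mathbb{E}^3$ and let $\mathcal{P}_{\mathbf{\Lambda}}$ be a regular polyhedron in the $3$-torus $\mathbb{T}^3_{\mathbf{\Lambda}}$. Then there exists a regular polyhedron $\mathcal{P}$ in $\mathbb{E}^3$ such that $\pi_{\mathbf{\Lambda}}(\mathcal{P})=\mathcal{P}_{\mathbf{\Lambda}}$.
   Context: A rank-$3$ lattice group $\mathbf{\Lambda}$ is a group of translations of $\mathbb{E}^3$ generated by three linearly independent translations; $\mathbb{T}^3_{\mathbf{\Lambda}}=\mathbb{E}^3/\mathbf{\Lambda}$ with the metric induced by the Euclidean metric, and $\pi_{\mathbf{\Lambda}}:\mathbb{E}^3\to\mathbb{T}^3_{\mathbf{\Lambda}}$ is the quotient map. A polyhedron is a connected graph (its $1$-skeleton, parallel edges allowed) together with a family of subgraphs called faces such that every edge lies in at least one face, every face is a connected $2$-valent graph, and every vertex figure (the graph whose nodes are the edges at a given vertex, two being adjacent when they belong to a common face) is a connected $2$-valent graph; equivalently, a rank-$3$ abstract polytope. It is regular if its automorphism group acts transitively on flags (mutually incident triples vertex–edge–face). A regular polyhedron in $\mathbb{E}^3$ is a regular polyhedron whose vertices are points of $\mathbb{E}^3$ forming a discrete set, whose edges are the line segments joining the two endpoints and whose faces are collections of such segments (distinct vertices, edges, faces giving distinct points, segments, collections), such that every automorphism is induced by an isometry of $\mathbb{E}^3$. A graph in $\mathbb{T}^3_{\mathbf{\Lambda}}$ is a set of points (vertices) with a set of geodesic arcs (edges), each having two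 distinct vertices as endpoints and no vertex in its interior. A regular polyhedron in $\mathbb{T}^3_{\mathbf{\Lambda}}$ is a regular polyhedron together with a toroidal realization that is discrete, faithful and symmetric: its $1$-skeleton is (identified by a graph isomorphism with) a graph in $\mathbb{T}^3_{\mathbf{\Lambda}}$ with discrete, hence finite, vertex set; each face is uniquely determined by the corresponding subgraph; and every automorphism is induced by an isometry of $\mathbb{T}^3_{\mathbf{\Lambda}}$. $\pi_{\mathbf{\Lambda}}(\mathcal{P})=\mathcal{P}_{\mathbf{\Lambda}}$ means that $\pi_{\mathbf{\Lambda}}$ maps the vertices, edges and faces of $\mathcal{P}$ onto the vertices, edges and faces of $\mathcal{P}_{\mathbf{\Lambda}}$, respectively. *)

(* Defs.v *)
From HB Require Import structures.
From mathcomp Require Import all_boot all_order all_algebra generic_quotient.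
From mathcomp Require Import boolp classical_sets reals.
From Stdlib Require Import Relations.Relation_Operators.
Set Implicit Arguments.
Unset Strict Implicit.
Unset Printing Implicit Defensive.
Import Order.TTheory GRing.Theory Num.Theory.
Local Open Scope classical_set_scope.
Local Open Scope ring_scope.
Local Open Scope quotient_scope.

Definition exactly_two (T : Type) (A : set T) : Prop :=
  exists x y : T, x <> y /\ A = [set x; y].

(* Raw incidence data of a multigraph: an arc is not determined by its ends,
   so parallel arcs are allowed.  [proper_graph] excludes loops. *)
Record graph := Graph {
  node : Type;
  arc : Type;
  ends : arc -> set node }.

Definition proper_graph (G : graph) : Prop :=
  forall a : arc G, exactly_two (ends a).

Definition adjacent (G : graph) (x y : node G) : Prop :=
  exists a : arc G, ends a x /\ ends a y.

(* A connected graph is nonempty. *)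
Definition connected_graph (G : graph) : Prop :=
  (exists x : node G, True) /\
  forall x y : node G, clos_refl_trans (node G) (@adjacent G) x y.

Definition two_valent (G : graph) : Prop :=
  forall x : node G, exactly_two [set a : arc G | ends a x].

(* Faces form an indexed family of subgraphs of the 1-skeleton: as in an
   abstract polytope, two faces may a priori have the same subgraph. *)
Record prepolyhedron := PrePolyhedron {
  skel :> graph;
  face : Type;
  fverts : face -> set (node skel);
  fedges : face -> set (arc skel) }.

Definition face_graph (P : prepolyhedron) (f : face P) : graph :=
  @Graph {v : node P | fverts f v} {e : arc P | fedges f e}
    (fun e v => ends (sval e) (sval v)).

(* The vertex figure is a multigraph with one arc for each face through the
   vertex, joining the edges of that face at the vertex; two edges sharing two
   faces are thus joined by two arcs. *)
Definition vertex_figure (P : prepolyhedron) (v : node P) : graph :=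
  @Graph {e : arc P | ends e v} {f : face P | fverts f v}
    (fun f e => fedges (sval f) (sval e)).

Record is_polyhedron (P : prepolyhedron) : Prop := IsPolyhedron {
  skel_proper : proper_graph P;
  skel_connected : connected_graph P;
  face_subgraph : forall (f : face P) (e : arc P),
    fedges f e -> ends e `<=` fverts f;
  edge_in_face : forall e : arc P, exists f : face P, fedges f e;
  face_connected : forall f : face P, connected_graph (face_graph f);
  face_two_valent : forall f : face P, two_valent (face_graph f);
  vfig_connected : forall v : node P, connected_graph (vertex_figure v);
  vfig_two_valent : forall v : node P, two_valent (vertex_figure v) }.

Record automorphism (P : prepolyhedron) := Automorphism {
  on_vert : node P -> node P;
  on_edge : arc P -> arc P;
  on_face : face P -> face P;
  on_vert_bij : bijective on_vert;
  on_edge_bij : bijective on_edge;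
  on_face_bij : bijective on_face;
  on_ends : forall e v, ends (on_edge e) (on_vert v) <-> ends e v;
  on_fverts : forall f v, fverts (on_face f) (on_vert v) <-> fverts f v;
  on_fedges : forall f e, fedges (on_face f) (on_edge e) <-> fedges f e }.

Definition is_flag (P : prepolyhedron) (v : node P) (e : arc P) (f : face P) :
    Prop :=
  [/\ ends e v, fedges f e & fverts f v].

Definition flag_transitive (P : prepolyhedron) : Prop :=
  forall v e f v' e' f', @is_flag P v e f -> @is_flag P v' e' f' ->
    exists phi : automorphism P,
      [/\ on_vert phi v = v', on_edge phi e = e' & on_face phi f = f'].

Definition regular_polyhedron (P : prepolyhedron) : Prop :=
  is_polyhedron P /\ flag_transitive P.

Record realized (X : Type) := Realized {
  poly :> prepolyhedron;
  rvert : node poly -> X;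
  redge : arc poly -> set X }.

Definition rface (X : Type) (P : realized X) (f : face P) : set (set X) :=
  @redge X P @` fedges f.
Arguments rvert {X} P _ : rename.
Arguments redge {X} P _ _ : rename.
Arguments rface {X} P _ _ : rename.

Definition faithful (X : Type) (P : realized X) : Prop :=
  [/\ injective (rvert P), injective (redge P) & injective (rface P)].

Section Metric.
Variables (R : realType) (X : Type) (d : X -> X -> R).

Definition isometry (g : X -> X) : Prop :=
  bijective g /\ forall x y, d (g x) (g y) = d x y.

(* Discrete in the sense of having no accumulation point in [X] (hence finite
   when [X] is compact). *)
Definition discrete (V : set X) : Prop :=
  forall x : X, exists2 eps : R, 0 < eps &
    forall y, V y -> d x y < eps -> y = x.

(* Geodesics are locally (not necessarily globally) length-minimizing; the
   curve is parametrized by arc length. *)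
Definition geodesic_arc (A : set X) (u v : X) : Prop :=
  exists (l : R) (gamma : R -> X), [/\ 0 < l, gamma 0 = u, gamma l = v,
    A = gamma @` [set t | 0 <= t <= l] &
    (forall s t, 0 <= s <= l -> 0 <= t <= l -> gamma s = gamma t -> s = t) /\
    (forall s, 0 <= s <= l -> exists2 eps : R, 0 < eps &
       forall t1 t2, 0 <= t1 <= l -> 0 <= t2 <= l ->
         `|t1 - s| < eps -> `|t2 - s| < eps ->
         d (gamma t1) (gamma t2) = `|t1 - t2|)].

Definition induced_by (P : realized X) (phi : automorphism P) (g : X -> X) :
    Prop :=
  [/\ forall v, rvert P (on_vert phi v) = g (rvert P v),
      forall e, redge P (on_edge phi e) = g @` redge P e &
      forall f, rface P (on_face phi f) = [set g @` A | A in rface P f]].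

Definition symmetric_realization (P : realized X) : Prop :=
  forall phi : automorphism P, exists2 g : X -> X,
    isometry g & induced_by phi g.

End Metric.

Section Euclidean.
Variable R : realType.

Definition E3 := 'rV[R]_3.

(* The norm carried by row vectors in the library is the sup norm. *)
Definition edist (x y : E3) : R :=
  Num.sqrt (\sum_(i < 3) (x ord0 i - y ord0 i) ^+ 2).

Definition segment (x y : E3) : set E3 :=
  [set z | exists2 t : R, 0 <= t <= 1 & z = (1 - t) *: x + t *: y].

Definition regular_in_E3 (P : realized E3) : Prop :=
  [/\ regular_polyhedron P,
      faithful P,
      discrete edist (range (rvert P)),
      forall e u v, u <> v -> ends e u -> ends e v ->
        redge P e = segment (rvert P u) (rvert P v) &
      symmetric_realization edist P].

(* A translation is identified with its vector. *)
Record lattice := Lattice {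
  translations : set E3;
  lattice_gen : exists B : 'M[R]_3, row_free B /\
    translations =
      [set v | exists z : 'I_3 -> int, v = \sum_i (z i)%:~R *: row i B] }.

Variable L : lattice.

Definition torus_rel : rel E3 := fun x y => `[< translations L (x - y) >].

Lemma lattice0 : translations L 0.
Proof.
case: (lattice_gen L) => B [_ ->]; exists (fun=> 0).
by rewrite big1 // => i _; rewrite mulr0z scale0r.
Qed.

Lemma latticeB x y :
  translations L x -> translations L y -> translations L (x - y).
Proof.
case: (lattice_gen L) => B [_ ->] [z ->] [w ->]; exists (fun i => z i - w i).
by rewrite -sumrB; apply: eq_bigr => i _; rewrite intrB scalerBl.
Qed.

Lemma torus_rel_refl : reflexive torus_rel.
Proof. by move=> x; apply/asboolP; rewrite subrr; exact: lattice0. Qed.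

Lemma torus_rel_sym : symmetric torus_rel.
Proof.
move=> x y; apply/asboolP/asboolP => h; rewrite -opprB -sub0r;
  exact: (latticeB lattice0).
Qed.

Lemma torus_rel_trans : transitive torus_rel.
Proof.
move=> y x z /asboolP xy; rewrite torus_rel_sym => /asboolP zy.
apply/asboolP; rewrite (_ : x - z = (x - y) - (z - y)); first exact: latticeB.
by rewrite opprB addrA subrK.
Qed.

Canonical torus_equiv :=
  EquivRel torus_rel torus_rel_refl torus_rel_sym torus_rel_trans.

Definition torus : Type := {eq_quot torus_equiv}.

Definition proj (x : E3) : torus := \pi_({eq_quot torus_equiv}) x.

Definition torus_dist (p q : torus) : R :=
  inf [set edist x y | x in [set x | proj x = p] & y in [set y | proj y = q]].

(* In the second clause, [rvert P w] lying on the arc of [e] forces [w] to be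
   one of its endpoints: no vertex lies in the interior of an edge. *)
Definition torus_graph (P : realized torus) : Prop :=
  (forall e u v, u <> v -> ends e u -> ends e v ->
     geodesic_arc torus_dist (redge P e) (rvert P u) (rvert P v)) /\
  (forall e w, redge P e (rvert P w) -> ends e w).

Definition regular_in_torus (P : realized torus) : Prop :=
  [/\ regular_polyhedron P,
      faithful P,
      discrete torus_dist (range (rvert P)),
      torus_graph P &
      symmetric_realization torus_dist P].

Definition projects_onto (P : realized E3) (Q : realized torus) : Prop :=
  [/\ proj @` range (rvert P) = range (rvert Q),
      [set proj @` A | A in range (redge P)] = range (redge Q) &
      [set [set proj @` A | A in C] | C in range (rface P)] = range (rface Q)].

End Euclidean.

(* Main.v *)
Require Import Defs.
From mathcomp Require Import all_boot all_order all_algebra generic_quotient.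
From mathcomp Require Import boolp classical_sets reals.
From mathcomp Require Import ring lra.
From Stdlib Require Import Relations.Relation_Operators Relations.Operators_Properties.

(** The projection of E^3 onto the torus is a local isometry, with a radius that
is uniform because nonzero lattice vectors are bounded away from 0
([lattice_gap], [proj_isometry_near]).  Two lifting properties follow.

An isometry of the torus lifts to an isometry of E^3, and the image of one point
can be prescribed within its fibre ([lift_isometry]).  Near that point the lift
is given by an orthogonal matrix, because a map that preserves norms and
distances preserves inner products.  The same matrix works everywhere: on a short
arithmetic progression of points of a line, two consecutive points determine
the next one by their distances to it, by strict convexity of the norm.

A geodesic arc of the torus lifts to a segment of E^3 from any point over its
origin ([geodesic_lift]), and this segment is unique ([lifts_to_unique]), even
though an arc is only given as a set of points.

Thus the points over the vertices and the segments over the edges form a graph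
that covers the skeleton of the torus polyhedron.  The required polyhedron
[lifted] is the component of this graph that contains a chosen point [x0]; its
faces are the components of the preimages of the faces.  Around a point over a
vertex, the covering is an isomorphism: edges, faces and their incidences are
those around the vertex, and the local axioms of polyhedra are inherited
([lifted_polyhedron]).  A lift of an isometry that realizes an automorphism
permutes the points, segments and components; prescribing the image of one
vertex of [lifted] makes it preserve the component, and hence any flag can be
moved to any other by an isometry ([lifted_flag_symmetry]).  Finally, an automorphism
of a polyhedron is determined by the image of one flag ([automorphism_rigid]),
so the automorphisms obtained in this way are all of them. *)

Import Defs.
Set Implicit Arguments.
Unset Strict Implicit.
Unset Printing Implicit Defensive.
Import Order.TTheory GRing.Theory Num.Theory.
Local Open Scope classical_set_scope.
Local Open Scope ring_scope.

(** * Euclidean norm *)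

Section EuclideanNorm.
Variable R : realType.
Implicit Types x y z : E3 R.

Definition dot x y : R := \sum_(i < 3) x ord0 i * y ord0 i.
Definition nrm x : R := Num.sqrt (dot x x).

Lemma dotC x y : dot x y = dot y x.
Proof. by apply: eq_bigr => i _; rewrite mulrC. Qed.

Lemma dotDl x y z : dot (x + y) z = dot x z + dot y z.
Proof. by rewrite -big_split; apply: eq_bigr => i _; rewrite !mxE mulrDl. Qed.

Lemma dotZl a x y : dot (a *: x) y = a * dot x y.
Proof. by rewrite mulr_sumr; apply: eq_bigr => i _; rewrite !mxE mulrA. Qed.

Lemma dotNl x y : dot (- x) y = - dot x y.
Proof. by rewrite -scaleN1r dotZl mulN1r. Qed.

Lemma dotDr x y z : dot z (x + y) = dot z x + dot z y.
Proof. by rewrite dotC dotDl !(dotC z). Qed.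

Lemma dotZr a x y : dot y (a *: x) = a * dot y x.
Proof. by rewrite dotC dotZl (dotC y). Qed.

Lemma dotNr x y : dot y (- x) = - dot y x.
Proof. by rewrite dotC dotNl (dotC y). Qed.

Definition dotE := (dotDl, dotDr, dotNl, dotNr, dotZl, dotZr).

Lemma dot_ge0 x : 0 <= dot x x.
Proof. by apply: sumr_ge0 => i _; rewrite -expr2 sqr_ge0. Qed.

Lemma dot_eq0 x : dot x x = 0 -> x = 0.
Proof.
move=> /eqP; rewrite psumr_eq0; last by move=> i _; rewrite -expr2 sqr_ge0.
move=> /allP h; apply/matrixP => i j; rewrite mxE (ord1 i).
by have /h := mem_index_enum j; rewrite /= mulf_eq0 orbb => /eqP.
Qed.

Lemma nrm_ge0 x : 0 <= nrm x. Proof. exact: sqrtr_ge0. Qed.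

Lemma sqr_nrm x : nrm x ^+ 2 = dot x x.
Proof. by rewrite sqr_sqrtr // dot_ge0. Qed.

Lemma nrm_eq0 x : nrm x = 0 -> x = 0.
Proof. by move=> h; apply: dot_eq0; rewrite -sqr_nrm h expr0n. Qed.

Lemma nrmZ a x : nrm (a *: x) = `|a| * nrm x.
Proof. by rewrite /nrm dotZl dotZr mulrA -expr2 sqrtrM ?sqr_ge0 // sqrtr_sqr. Qed.

Lemma nrmN x : nrm (- x) = nrm x.
Proof. by rewrite /nrm dotNl dotNr opprK. Qed.

Lemma nrmB x y : nrm (x - y) = nrm (y - x).
Proof. by rewrite -nrmN opprB. Qed.

Lemma cauchy_schwarz x y : dot x y <= nrm x * nrm y.
Proof.
have [->|/eqP y0] := eqVneq y 0.
  by rewrite dotC -(scale0r 0) dotZl mul0r mulr_ge0 ?nrm_ge0.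
have ny : 0 < nrm y.
  by rewrite lt_def nrm_ge0 andbT; apply/eqP => /nrm_eq0.
have [->|/eqP x0] := eqVneq x 0.
  by rewrite -(scale0r 0) dotZl mul0r mulr_ge0 ?nrm_ge0.
have nx : 0 < nrm x.
  by rewrite lt_def nrm_ge0 andbT; apply/eqP => /nrm_eq0.
have := dot_ge0 (nrm y *: x - nrm x *: y).
rewrite !dotE -!sqr_nrm (dotC y x) => h.
have : 0 <= (nrm x * nrm y) * (nrm x * nrm y - dot x y) by nra.
by rewrite pmulr_rge0 ?mulr_gt0 // subr_ge0.
Qed.

Lemma nrm_triangle x y : nrm (x + y) <= nrm x + nrm y.
Proof.
rewrite -(@ler_pXn2r _ 2) ?nnegrE ?addr_ge0 ?nrm_ge0 // sqr_nrm !dotE.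
by rewrite sqrrD -!sqr_nrm (dotC y x); have := cauchy_schwarz x y; lra.
Qed.

Lemma dot_polar x y :
  2 * dot x y = nrm x ^+ 2 + nrm y ^+ 2 - nrm (x - y) ^+ 2.
Proof. by rewrite !sqr_nrm !dotE (dotC y x); lra. Qed.

(** Strict convexity turns equality in the triangle inequality into alignment:
this is what makes isometries and geodesics straight. *)
Lemma nrm_strictly_convex x y r :
  nrm x = r -> nrm y = r -> nrm (x + y) = 2 * r -> x = y.
Proof.
move=> hx hy hxy; apply/eqP; rewrite -subr_eq0; apply/eqP/dot_eq0.
have := dot_polar x (- y); rewrite opprK nrmN hx hy hxy dotNr => h.
by rewrite !dotE -!sqr_nrm hx hy (dotC y x); lra.
Qed.

Lemma edistE x y : edist x y = nrm (x - y).
Proof.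
by congr (Num.sqrt _); apply: eq_bigr => i _; rewrite !mxE expr2.
Qed.

Lemma edist_ge0 x y : 0 <= edist x y. Proof. by rewrite edistE nrm_ge0. Qed.

Lemma dot_mulmx x y (M : 'M[R]_3) :
  M *m M^T = 1%:M -> dot (x *m M) (y *m M) = dot x y.
Proof.
have dotm u v : dot u v = (u *m v^T) ord0 ord0.
  by rewrite mxE; apply: eq_bigr => i _; rewrite mxE.
by move=> MM; rewrite !dotm trmx_mul mulmxA -(mulmxA x) MM mulmx1.
Qed.

Lemma abs_coord_le x i : `|x ord0 i| <= nrm x.
Proof.
rewrite -sqrtr_sqr ler_sqrt ?dot_ge0 // /dot (bigD1 i) //= -expr2 lerDl.
by apply: sumr_ge0 => j _; rewrite -expr2 sqr_ge0.
Qed.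

End EuclideanNorm.

(** * Induction on a real interval *)

Section Reals.
Variable R : realType.

(** If [b] were not in [S], the step at the supremum [T] of the points of [S] in the
interval would give a point of [S] beyond [T]. As [T] itself need not be in [S],
the step starts from some [t0] slightly before it. *)
Lemma continuous_induction (S : R -> Prop) (a b : R) :
  a <= b -> S a ->
  (forall T, a <= T <= b -> exists2 eps, 0 < eps & forall t0 t,
     a <= t0 <= T -> T - eps < t0 -> S t0 -> t0 <= t <= b -> t < T + eps ->
     S t) ->
  S b.
Proof.
move=> ab Sa step.
pose A := [set t | a <= t <= b /\ S t].
have A0 : A a by rewrite /A /= lexx ab.
have ubA : ubound A b by move=> t [/andP[]].
have hsA : has_sup A by split; [exists a | exists b].
have aT : a <= sup A by apply: ub_le_sup => //; exists b.
have Tb : sup A <= b by apply: ge_sup => //; exists a.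
have [|eps eps0 h] := step (sup A); first by rewrite aT.
have [t0 [/andP[at0 t0b] St0] Tt0] := sup_adherent eps0 hsA.
have t0T : t0 <= sup A by apply: ub_le_sup; [exists b | split => //; apply/andP].
have [bT|Teb] := ltP b (sup A + eps).
  by apply: (h t0 b) => //; apply/andP.
have St : S (sup A + eps / 2).
  apply: (h t0) => //; first (by apply/andP); last lra.
  by apply/andP; split; lra.
have : sup A + eps / 2 <= sup A.
  apply: ub_le_sup; first by exists b.
  by split => //; apply/andP; split; lra.
lra.
Qed.

End Reals.

(** * The projection onto the torus is a local isometry *)

(** Linear identities between vectors are checked coordinatewise. *)
Ltac vector := by apply/matrixP => ? ?; rewrite !mxE; ring.

Section Torus.
Variables (R : realType) (L : lattice R).
Implicit Types (x y z u v w : E3 R) (A : set (torus L)).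
Notation pi := (@proj R L).
Notation td := (@torus_dist R L).

Lemma projP x y : pi x = pi y <-> translations L (x - y).
Proof.
split; first by move=> /eqquotP/asboolP.
by move=> h; apply/eqquotP/asboolP.
Qed.

Lemma proj_surj p : exists x, pi x = p.
Proof. by exists (repr p); rewrite /proj reprK. Qed.

Lemma projD x y v : pi x = pi y -> pi (x + v) = pi (y + v).
Proof. by move=> /projP h; apply/projP; rewrite opprD addrACA subrr addr0. Qed.

(** The coordinates of a lattice vector in a basis of the lattice are integers, and
they are bounded by a multiple of its norm; if it is short, they vanish. *)
Lemma lattice_gap :
  exists2 rho : R, 0 < rho & forall v, translations L v -> nrm v < rho -> v = 0.
Proof.
have [B [freeB ->]] := lattice_gen L.
pose C : R := 1 + \sum_i \sum_j `|invmx B i j|.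
have C0 : 0 < C.
  by rewrite ltr_wpDr // sumr_ge0 // => i _; rewrite sumr_ge0.
exists C^-1; rewrite ?invr_gt0 // => _ [z ->].
set v := \sum_i _ => hv.
have vE : v = (\row_i (z i)%:~R) *m B.
  by rewrite mulmx_sum_row; apply: eq_bigr => i _; rewrite mxE.
have Bu : B \in unitmx by rewrite -row_free_unit.
have zE i : (z i)%:~R = \sum_j v ord0 j * invmx B j i.
  by have := congr1 (fun w => (w *m invmx B) ord0 i) vE; rewrite mulmxK // !mxE.
have z0 i : z i = 0.
  have : `|(z i)%:~R : R| < 1.
    apply: (@le_lt_trans _ _ (nrm v * C)); last by rewrite -ltr_pdivlMr // mul1r.
    rewrite zE (le_trans (ler_norm_sum _ _ _)) //.
    apply: (@le_trans _ _ (nrm v * \sum_j `|invmx B j i|)).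
      rewrite mulr_sumr; apply: ler_sum => j _; rewrite normrM.
      by rewrite ler_wpM2r // abs_coord_le.
    rewrite ler_wpM2l ?nrm_ge0 // /C addrC.
    rewrite (le_trans _ (_ : \sum_i0 \sum_j `|invmx B i0 j| <= _)) //;
      last by rewrite lerDl.
    apply: ler_sum => j _; rewrite (bigD1 i) //= lerDl.
    by apply: sumr_ge0.
  by rewrite -intr_norm ltrz1 -abszE -[1]/(1%N%:Z) ltz_nat ltnS leqn0 absz_eq0 => /eqP.
by rewrite /v big1 // => i _; rewrite z0 mulr0z scale0r.
Qed.

Section Gap.

Let dists p q :=
  [set edist x y | x in [set x | pi x = p] & y in [set y | pi y = q]].

Lemma torus_dist_le x y : td (pi x) (pi y) <= nrm (x - y).
Proof.
rewrite -edistE; apply: ge_inf; last by exists x => //; exists y.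
by exists 0 => _ [a _ [b _ <-]]; exact: edist_ge0.
Qed.

(** A translation moves any almost optimal pair of representatives to one that
starts at [x]. *)
Lemma torus_dist_lt x y r :
  td (pi x) (pi y) < r -> exists2 y', pi y' = pi y & nrm (x - y') < r.
Proof.
move=> h; have [] := @inf_adherent _ (dists (pi x) (pi y)) (r - td (pi x) (pi y)).
- by rewrite subr_gt0.
- split; first by exists (edist x y); exists x => //; exists y.
  by exists 0 => _ [a _ [b _ <-]]; exact: edist_ge0.
move=> _ [a /= ax [b /= bx <-]]; rewrite -/(td _ _) addrC subrK edistE => ab.
exists (b + (x - a)); first by rewrite (projD _ bx); apply/projP;
  rewrite addrAC subrr add0r; apply/projP.
by rewrite (_ : x - _ = a - b) //; vector.
Qed.

Variable rho : R.
Hypothesis rho0 : 0 < rho.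
Hypothesis rho_gap : forall v, translations L v -> nrm v < rho -> v = 0.

Lemma proj_inj_near x y : pi x = pi y -> nrm (x - y) < rho -> x = y.
Proof. by move=> /projP h /(rho_gap h) /eqP; rewrite subr_eq0 => /eqP. Qed.

(** A second point over [pi y] that is closer to [x] would be at a distance less than
[rho] from [y]. *)
Lemma proj_isometry_near x y :
  nrm (x - y) < rho / 2 -> td (pi x) (pi y) = nrm (x - y).
Proof.
move=> h; apply/eqP; rewrite eq_le torus_dist_le /= leNgt; apply/negP.
move=> /torus_dist_lt [y' y'y xy']; move: (xy').
rewrite (proj_inj_near y'y) ?ltxx //.
rewrite (_ : y' - y = (x - y) - (x - y')); last by vector.
by apply: le_lt_trans (nrm_triangle _ _) _; rewrite nrmN; lra.
Qed.

(** Below the radius, the infimum that defines the distance is attained. *)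
Lemma torus_dist_lift x q :
  td (pi x) q < rho / 2 -> exists2 w, pi (x + w) = q & nrm w = td (pi x) q.
Proof.
have [y <-] := proj_surj q => /[dup] h /torus_dist_lt [y' y'y xy'].
exists (y' - x); first by rewrite addrC subrK.
by rewrite -y'y nrmB proj_isometry_near // nrmB.
Qed.

Lemma torus_dist_gt0 p q : p <> q -> 0 < td p q.
Proof.
have [x <-] := proj_surj p; have [y <-] := proj_surj q => xy.
rewrite ltNge; apply/negP => h; have [|w hw nw] := @torus_dist_lift x (pi y).
  by apply: le_lt_trans h _; rewrite divr_gt0.
apply: xy; rewrite -hw (@nrm_eq0 _ w) ?addr0 //.
by apply/eqP; rewrite eq_le nrm_ge0 nw h.
Qed.

Lemma torus_dist_triangle p q r : td p r <= td p q + td q r.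
Proof.
have [x <-] := proj_surj p; have [y <-] := proj_surj q.
have [z <-] := proj_surj r; apply/ler_addgt0Pr => e e0.
have [|y' y'y xy] := @torus_dist_lt x y (td (pi x) (pi y) + e / 2).
  by rewrite ltrDl divr_gt0.
rewrite -y'y; have [|z' z'z yz] := @torus_dist_lt y' z (td (pi y') (pi z) + e / 2).
  by rewrite ltrDl divr_gt0.
rewrite -z'z; apply: le_trans (torus_dist_le _ _) _.
have := nrm_triangle (x - y') (y' - z'); rewrite addrA subrK z'z y'y in xy yz *.
lra.
Qed.

(** * Lifting isometries *)

Section LiftIsometry.
Variables (g : torus L -> torus L) (x0 y0 : E3 R).
Hypothesis g_dist : forall p q, td (g p) (g q) = td p q.
Hypothesis g_x0 : pi y0 = g (pi x0).
(* Sums of up to three vectors shorter than sigma stay below rho / 2. *)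
Let sigma := rho / 8.

(** Near [x0], the isometry lifts to a map [h] of vectors, with origins [x0] and [y0],
that preserves norms and distances, hence inner products. The images of three
short orthogonal vectors then give the matrix [M], and [h u] is determined by its
inner products with them. *)
Lemma lift_isometry_local : exists M : 'M[R]_3, M *m M^T = 1%:M /\
  forall u, nrm u < sigma -> pi (y0 + u *m M) = g (pi (x0 + u)).
Proof.
have sigma0 : 0 < sigma by rewrite divr_gt0.
have rs : rho / 2 = 4 * sigma by rewrite /sigma; lra.
have addsub a b c : a + b - (a + c) = b - c :> E3 R.
  by rewrite opprD addrACA subrr add0r.
have exh u : exists w, nrm u < sigma ->
    pi (y0 + w) = g (pi (x0 + u)) /\ nrm w = nrm u.
  have [us|] := boolP (nrm u < sigma); last by exists 0.
  have e : td (pi y0) (g (pi (x0 + u))) = nrm u.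
    have xu : x0 - (x0 + u) = - u by rewrite opprD addNKr.
    by rewrite g_x0 g_dist proj_isometry_near xu nrmN // rs; lra.
  have [|w h1 h2] := @torus_dist_lift y0 (g (pi (x0 + u))); first by rewrite e rs; lra.
  by exists w => _; split=> //; rewrite h2.
have [h hP] := choice exh.
have hdist u v : nrm u < sigma -> nrm v < sigma -> nrm (h u - h v) = nrm (u - v).
  move=> us vs; have [hu nu] := hP _ us; have [hv nv] := hP _ vs.
  have := nrm_triangle u (- v); have := nrm_triangle (h u) (- h v).
  rewrite !nrmN nu nv => l1 l2.
  have : td (pi (y0 + h u)) (pi (y0 + h v)) = nrm (h u - h v).
    by rewrite proj_isometry_near addsub // rs; lra.
  by move=> <-; rewrite hu hv g_dist proj_isometry_near addsub // rs; lra.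
have hdot u v : nrm u < sigma -> nrm v < sigma -> dot (h u) (h v) = dot u v.
  move=> us vs; have [_ nu] := hP _ us; have [_ nv] := hP _ vs.
  have := dot_polar (h u) (h v); rewrite hdist // nu nv -dot_polar; lra.
pose b (i : 'I_3) : E3 R := (sigma / 2) *: delta_mx ord0 i.
have dotb u i : dot u (b i) = sigma / 2 * u ord0 i.
  rewrite dotZr /dot (bigD1 i) //= big1 ?addr0; last first.
    by move=> j ji; rewrite mxE eqxx (negPf ji) mulr0.
  by rewrite mxE !eqxx mulr1.
have nb i : nrm (b i) < sigma.
  rewrite nrmZ (_ : nrm _ = 1) ?mulr1 ?ger0_norm; try lra.
  rewrite /nrm /dot (bigD1 i) //= big1 ?addr0; last first.
    by move=> j ji; rewrite mxE eqxx (negPf ji) mulr0.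
  by rewrite mxE !eqxx mulr1 sqrtr1.
pose M : 'M[R]_3 := \matrix_(i, j) (2 / sigma * h (b i) ord0 j).
have coordM w i : (w *m M^T) ord0 i = 2 / sigma * dot w (h (b i)).
  by rewrite mxE /dot mulr_sumr; apply: eq_bigr => j _; rewrite !mxE mulrCA.
have c1 : 2 / sigma * (sigma / 2) = 1 by field; lra.
have hM u : nrm u < sigma -> h u *m M^T = u.
  move=> us; apply/matrixP => i j; rewrite (ord1 i) coordM hdot //.
  by rewrite dotb mulrA c1 mul1r.
have MM : M *m M^T = 1%:M.
  apply/row_matrixP => i; rewrite row_mul.
  have -> : row i M = (2 / sigma) *: h (b i).
    by apply/matrixP => k j; rewrite (ord1 k) !mxE.
  by rewrite -scalemxAl hM // scalerA c1 scale1r row1.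
exists M; split=> // u us; have [<- _] := hP _ us.
by rewrite -{1}(hM _ us) -mulmxA (mulmx1C MM) mulmx1.
Qed.

(** The matrix found near [x0] works everywhere: on the ray from [x0] in a short
direction [u], the image of the point [n + 2] is the only point that is at distance
[nrm u] from the image of [n + 1] and [2 * nrm u] from the image of [n]. *)
Lemma lift_isometry_global M : M *m M^T = 1%:M ->
  (forall u, nrm u < sigma -> pi (y0 + u *m M) = g (pi (x0 + u))) ->
  forall x, pi (y0 + (x - x0) *m M) = g (pi x).
Proof.
move=> MM loc.
have sigma0 : 0 < sigma by rewrite divr_gt0.
have rs : rho / 2 = 4 * sigma by rewrite /sigma; lra.
have nM u : nrm (u *m M) = nrm u by rewrite /nrm dot_mulmx.
have ray u n : nrm u < sigma ->
    pi (y0 + n%:R *: (u *m M)) = g (pi (x0 + n%:R *: u)).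
  move=> us; elim/ltn_ind: n => -[|[|n]] IH; first by rewrite !scale0r !addr0.
    by rewrite !scale1r; apply: loc.
  (* q and r are the points n + 1 of the two rays, and w is the step from q to a
     point over the image of the next point. *)
  have h1 := IH n (ltnW (leqnn _)); have h2 := IH n.+1 (leqnn _).
  pose q := y0 + n.+1%:R *: (u *m M); pose r := x0 + n.+1%:R *: u.
  have SE (a : E3 R) k : k.+1%:R *: a = k%:R *: a + a :> E3 R.
    by rewrite -natr1 scalerDl scale1r.
  rewrite (SE u n.+1) (SE (u *m M) n.+1) !addrA -/q -/r.
  have qE : pi (q - u *m M) = g (pi (r - u)).
    by rewrite /q /r !SE !addrA !addrK.
  have e1 : td (pi q) (g (pi (r + u))) = nrm u.
    have ru : r - (r + u) = - u by rewrite opprD addNKr.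
    by rewrite h2 g_dist proj_isometry_near ru nrmN // rs; lra.
  have e2 : td (pi (q - u *m M)) (g (pi (r + u))) = 2 * nrm u.
    have ru : r - u - (r + u) = (- 2) *: u.
      by vector.
    have nru : nrm ((- 2) *: u) = 2 * nrm u by rewrite nrmZ normrN normr_nat.
    by rewrite qE g_dist proj_isometry_near ru nru // rs; lra.
  have [|w hw nw] := @torus_dist_lift q (g (pi (r + u))); first by rewrite e1 rs; lra.
  rewrite -hw; congr (pi (q + _)); apply: (@nrm_strictly_convex _ _ _ (nrm u)) => //.
    by rewrite nw.
  rewrite -e2 -hw proj_isometry_near; last first.
    have -> : q - u *m M - (q + w) = - (u *m M + w).
      by vector.
    rewrite nrmN; apply: le_lt_trans (nrm_triangle _ _) _.
    by rewrite nM nw e1 rs; lra.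
  by rewrite -nrmN; congr nrm; vector.
(* Any vector is a multiple of a short one. *)
move=> x; pose n := (Num.truncn (nrm (x - x0) / sigma)).+1.
have n0 : (n%:R : R) != 0 by rewrite pnatr_eq0.
have := ray (n%:R^-1 *: (x - x0)) n.
rewrite -scalemxAl !scalerA mulfV // !scale1r (addrC x0) subrK; apply.
rewrite nrmZ ger0_norm ?invr_ge0 ?ler0n // mulrC ltr_pdivrMr ?ltr0n //.
by rewrite mulrC -ltr_pdivrMr // truncnS_gt.
Qed.

End LiftIsometry.

End Gap.

Lemma segmentE x y :
  segment x y = [set x + t *: (y - x) | t in [set t : R | 0 <= t <= 1]].
Proof.
apply/seteqP; split=> z /=.
  by move=> [t t01 ->]; exists t => //; vector.
by move=> [t t01 <-]; exists t => //; vector.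
Qed.

Lemma segment_sym x y : segment x y = segment y x.
Proof.
have sub (a b : E3 R) : segment a b `<=` segment b a.
  move=> z [t /andP[t0 t1] ->]; exists (1 - t); first by apply/andP; split; lra.
  by vector.
by apply/seteqP; split; exact: sub.
Qed.

Lemma segment_left x y : segment x y x.
Proof. by exists 0; [rewrite lexx ler01 | vector]. Qed.

Lemma segment_right x y : segment x y y.
Proof. by rewrite segment_sym; exact: segment_left. Qed.

Lemma lift_isometry (g : torus L -> torus L) x0 y0 :
  isometry td g -> pi y0 = g (pi x0) ->
  exists h : E3 R -> E3 R, [/\ isometry (@edist R) h, h x0 = y0,
    forall x, pi (h x) = g (pi x) &
    forall x y, h @` segment x y = segment (h x) (h y)].
Proof.
move=> [_ gd] gx; have [rho rho0 gap] := lattice_gap.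
have [M [MM loc]] := lift_isometry_local rho0 gap gd gx.
have glob := lift_isometry_global rho0 gap gd gx MM loc.
pose h x := y0 + (x - x0) *m M.
have hB x y : h x - h y = (x - y) *m M.
  by rewrite /h opprD addrACA subrr add0r -mulmxBl; congr (_ *m _); vector.
have hseg x y t : h ((1 - t) *: x + t *: y) = (1 - t) *: h x + t *: h y.
  rewrite /h; have -> : (1 - t) *: x + t *: y - x0 =
    (1 - t) *: (x - x0) + t *: (y - x0) by vector.
  by rewrite mulmxDl -!scalemxAl; vector.
exists h; split=> //.
- split; last by move=> x y; rewrite !edistE hB /nrm dot_mulmx.
  exists (fun y => x0 + (y - y0) *m M^T) => x.
    by rewrite /h (addrAC y0) subrr add0r -mulmxA MM mulmx1 addrC subrK.
  by rewrite /h (addrAC x0) subrr add0r -mulmxA (mulmx1C MM) mulmx1 addrC subrK.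
- by rewrite /h subrr mul0mx addr0.
- move=> x y; apply/seteqP; split=> z /=.
    by move=> [_ [t t01 ->] <-]; exists t.
  by move=> [t t01 ->]; exists ((1 - t) *: x + t *: y) => //; exists t.
Qed.

(** * Lifting geodesic arcs *)

(** At two nearby times the difference of the two lines is a lattice vector, and
these two lattice vectors differ by less than the gap. *)
Lemma proj_line_unique (a b x y : E3 R) (r s : R) : r < s ->
  (forall t, r < t < s -> pi (x + t *: a) = pi (y + t *: b)) -> a = b.
Proof.
move=> rs h; have [rho rho0 gap] := lattice_gap.
pose m := (r + s) / 2; pose N := nrm (a - b) + 1.
have N0 : 0 < N by rewrite ltr_wpDl ?nrm_ge0.
pose e := Num.min ((s - r) / 4) (rho / N).
have e0 : 0 < e by rewrite lt_min !divr_gt0 // subr_gt0.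
have e1 : e <= (s - r) / 4 by rewrite ge_min lexx.
have e2 : e * N <= rho by rewrite -ler_pdivlMr // ge_min lexx orbT.
have t1 : r < m < s by rewrite /m; apply/andP; split; lra.
have t2 : r < m + e < s by rewrite /m; apply/andP; split; lra.
have /projP l1 := h _ t1; have /projP l2 := h _ t2.
have /gap := latticeB l2 l1.
have -> : x + (m + e) *: a - (y + (m + e) *: b) - (x + m *: a - (y + m *: b))
  = e *: (a - b) by vector.
move=> /(_ _) /eqP; rewrite scaler_eq0 (gt_eqF e0) subr_eq0 => ab; apply/eqP/ab.
rewrite nrmZ gtr0_norm //; apply: lt_le_trans e2.
by rewrite ltr_pM2l // ltrDl.
Qed.

Section Geodesic.
Variables (l : R) (gamma : R -> torus L).
Hypothesis l0 : 0 < l.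

(** Near the time [s], the lift of the curve embeds an interval isometrically into
E^3; its inner products are those of the interval, so it is a straight line. *)
Lemma geodesic_lift_local s eps : 0 <= s <= l -> 0 < eps ->
  (forall t1 t2, 0 <= t1 <= l -> 0 <= t2 <= l ->
     `|t1 - s| < eps -> `|t2 - s| < eps -> td (gamma t1) (gamma t2) = `|t1 - t2|) ->
  exists2 e, 0 < e & exists x a : E3 R, forall t, 0 <= t <= l -> `|t - s| < e ->
    gamma t = pi (x + t *: a).
Proof.
move=> sl eps0 hd; have [rho rho0 gap] := lattice_gap.
pose e := Num.min eps (rho / 4).
have e0 : 0 < e by rewrite lt_min eps0 divr_gt0.
have ee : e <= eps by rewrite ge_min lexx.
have er : e <= rho / 4 by rewrite ge_min lexx orbT.
have [x0 x0s] := proj_surj (gamma s).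
pose I t := 0 <= t <= l /\ `|t - s| < e.
have exh t : exists w, I t -> gamma t = pi (x0 + w) /\ nrm w = `|t - s|.
  have [[tl te]|nI] := pselect (I t); last by exists 0.
  have dt : td (pi x0) (gamma t) = `|t - s|.
    by rewrite x0s hd ?subrr ?normr0 ?(lt_le_trans te) // distrC.
  have [|w h1 h2] := @torus_dist_lift rho gap x0 (gamma t).
    by rewrite dt; lra.
  by exists w; rewrite h2 h1.
have [h hP] := choice exh.
have hdist t t' : I t -> I t' -> nrm (h t - h t') = `|t - t'|.
  move=> It It'; have [h1 n1] := hP _ It; have [h2 n2] := hP _ It'.
  case: It It' => tl te [tl' te'].
  rewrite -hd ?(lt_le_trans _ ee) // h1 h2 (proj_isometry_near gap).
    by congr nrm; vector.
  have -> : x0 + h t - (x0 + h t') = h t - h t' by vector.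
  apply: le_lt_trans (nrm_triangle _ _) _; rewrite nrmN n1 n2; lra.
have hdot t t' : I t -> I t' -> dot (h t) (h t') = (t - s) * (t' - s).
  move=> It It'; have := dot_polar (h t) (h t'); rewrite hdist //.
  have [_ ->] := hP _ It; have [_ ->] := hP _ It'.
  rewrite -!normrX !ger0_norm ?sqr_ge0 //; lra.
(* A second time t1 in the neighbourhood, on the side where there is room. *)
have [t1 It1 t1s] : exists2 t, I t & t - s != 0.
  have /andP[s0 sl'] := sl; pose m := Num.min (e / 2) (l / 2).
  have m0 : 0 < m by rewrite lt_min !divr_gt0.
  have me : m <= e / 2 by rewrite ge_min lexx.
  have ml : m <= l / 2 by rewrite ge_min lexx orbT.
  have [sl2|sl2] := ltP s (l / 2).
    exists (s + m); rewrite ?[_ - s]addrAC ?subrr ?add0r ?gt_eqF //.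
    split; first by apply/andP; split; lra.
    by rewrite addrAC subrr add0r gtr0_norm //; lra.
  exists (s - m); rewrite ?[_ - s]addrAC ?subrr ?add0r ?oppr_eq0 ?gt_eqF //.
  split; first by apply/andP; split; lra.
  by rewrite addrAC subrr add0r normrN gtr0_norm //; lra.
pose a : E3 R := (t1 - s)^-1 *: h t1.
have hE t : I t -> h t = (t - s) *: a.
  move=> It; apply/eqP; rewrite -subr_eq0; apply/eqP/dot_eq0.
  rewrite /a !dotE (dotC (h t1)) !hdot //.
  by field.
exists e => //; exists (x0 - s *: a), a => t tl te.
have [-> _] := hP t (conj tl te); rewrite (hE t) //.
by congr pi; vector.
Qed.

(** Local lifts are glued along [0, l]: two of them that overlap have the same
direction, hence the set of the times up to which a straight lift from [x]
exists is open and closed. *)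
Lemma geodesic_lift_line x : pi x = gamma 0 ->
  (forall s, 0 <= s <= l -> exists2 eps : R, 0 < eps &
     forall t1 t2, 0 <= t1 <= l -> 0 <= t2 <= l ->
       `|t1 - s| < eps -> `|t2 - s| < eps ->
       td (gamma t1) (gamma t2) = `|t1 - t2|) ->
  exists a : E3 R, forall t, 0 <= t <= l -> gamma t = pi (x + t *: a).
Proof.
move=> x0 geo.
pose S r := exists a : E3 R, forall t, 0 <= t <= r -> gamma t = pi (x + t *: a).
apply: (@continuous_induction _ S 0 l); first exact: ltW.
  by exists 0 => t t0; rewrite scaler0 addr0 x0; congr gamma; lra.
move=> T Tl; have [eps eps0 hd] := geo T Tl.
have [e e0 [y [b hb]]] := geodesic_lift_local Tl eps0 hd.
exists e => // t0 t /andP[t00 t0T] Te [a ha] /andP[t0t tl] tT.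
have near r : Num.max 0 (T - e) <= r <= t -> T - e < r -> gamma r = pi (y + r *: b).
  rewrite ge_max => /andP[/andP[r0 _] rt] Tr; apply: hb.
    by rewrite r0 (le_trans rt).
  by rewrite ltr_norml; apply/andP; split; lra.
have ov r : t0 <= r <= t -> gamma r = pi (y + r *: b).
  move=> /andP[tr rt]; apply: near; last lra.
  by rewrite ge_max rt (le_trans t00 tr) andbT /=; lra.
(* The line from x and the local lift overlap just before t0. *)
have ab : 0 < t0 -> a = b.
  move=> t0p; apply: (@proj_line_unique a b x y (Num.max 0 (T - e)) t0).
    by rewrite gt_max t0p.
  move=> q /andP[]; rewrite gt_max => /andP[q0 Tq] qt0.
  rewrite -ha ?near //; last by rewrite !ltW.
  by rewrite (le_trans (ltW qt0)) // andbT ge_max !ltW.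
have xy : pi (x + t0 *: b) = pi (y + t0 *: b).
  rewrite -ov ?lexx ?t0t //; have [t0p|t0n] := ltP 0 t0.
    by rewrite ha ?t00 ?lexx // ab.
  have -> : t0 = 0 by lra.
  by rewrite scale0r addr0 x0.
exists b => r /andP[r0 rt].
have [t0r|rt0] := leP t0 r.
  rewrite ov ?t0r //; have := projD ((r - t0) *: b) xy.
  have E (z : E3 R) : z + t0 *: b + (r - t0) *: b = z + r *: b by vector.
  by rewrite !E => ->.
by rewrite ha ?r0 ?(ltW rt0) // ab // (le_lt_trans r0).
Qed.

End Geodesic.

(** The parametrization of the arc is forgotten, because the isometry that realizes
an automorphism is only known to preserve edges as sets of points. *)
Definition lifts_to (A : set (torus L)) x y : Prop :=
  pi @` segment x y = A /\
  (forall z w, segment x y z -> segment x y w -> pi z = pi w -> z = w).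

Lemma lifts_to_sym A x y : lifts_to A x y -> lifts_to A y x.
Proof. by rewrite /lifts_to segment_sym. Qed.

Lemma geodesic_lift A p q x : geodesic_arc td A p q -> pi x = p ->
  exists2 y, pi y = q & lifts_to A x y.
Proof.
move=> [l [gamma [l0 g0 gl -> [ginj geo]]]] xp.
have [|a ha] := @geodesic_lift_line l gamma l0 x _ geo; first by rewrite xp.
have pt t : 0 <= t <= 1 -> 0 <= t * l <= l.
  by move=> /andP[t0 t1]; have l0' := ltW l0; rewrite mulr_ge0 //= ler_piMl.
have segP t : x + t *: (x + l *: a - x) = x + (t * l) *: a by vector.
exists (x + l *: a); first by rewrite -ha ?lexx ?ltW.
split; rewrite segmentE.
  apply/seteqP; split=> z /=.
    by move=> [_ [t t01 <-] <-]; exists (t * l); [exact: pt | rewrite segP ha ?pt].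
  move=> [t /andP[t0 tl] <-]; exists (x + t *: a); last by rewrite ha ?t0.
  exists (t / l); last by rewrite segP divfK ?gt_eqF.
  by rewrite divr_ge0 ?(ltW l0) //= ler_pdivrMr // mul1r.
move=> _ _ [t t01 <-] [s s01 <-]; rewrite !segP -!ha ?pt // => /ginj.
by move=> ->//; exact: pt.
Qed.

(** An injective lift does not come back near its origin: the distance to the origin
is continuous and positive on the compact interval from [eta] to 1. *)
Lemma lifts_to_start_isolated A x y eta : lifts_to A x y -> x <> y ->
  0 < eta <= 1 -> exists2 d, 0 < d &
  forall t, eta <= t <= 1 -> d <= td (pi (x + t *: (y - x))) (pi x).
Proof.
move=> [_ inj] xy /andP[eta0 eta1]; have [rho rho0 gap] := lattice_gap.
pose D t := td (pi (x + t *: (y - x))) (pi x).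
have D0 t : eta <= t <= 1 -> 0 < D t.
  move=> /andP[te t1]; apply: (torus_dist_gt0 rho0 gap) => /inj.
  move=> /(_ _ (segment_left _ _)); rewrite segmentE => h.
  have : x + t *: (y - x) = x.
    by apply: h; exists t => //; apply/andP; split; lra.
  move=> /eqP; rewrite -subr_eq0 addrAC subrr add0r scaler_eq0 subr_eq0.
  by case/orP => [/eqP t0|/eqP yx]; [move: eta0 te; lra | case: xy].
have Dlip t s : D t <= D s + `|t - s| * nrm (y - x).
  rewrite addrC; apply: le_trans (torus_dist_triangle _ (pi (x + s *: (y - x))) _) _.
  rewrite lerD2r; apply: le_trans (torus_dist_le _ _) _.
  by rewrite -nrmZ (_ : _ - _ = (t - s) *: (y - x)) //; vector.
pose S r := exists2 d, 0 < d & forall t, eta <= t <= r -> d <= D t.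
apply: (@continuous_induction _ S eta 1) => //.
  exists (D eta); first by rewrite D0 ?lexx.
  by move=> t t0; have -> : t = eta by lra.
move=> T T1; pose N := nrm (y - x) + 1.
have N0 : 0 < N by rewrite ltr_wpDl ?nrm_ge0.
exists (D T / (2 * N)); first by rewrite divr_gt0 ?D0 ?mulr_gt0.
move=> t0 t t0T Tt0 [d d0 hd] t0t tT.
exists (Num.min d (D T / 2)); first by rewrite lt_min d0 divr_gt0 // D0.
move=> s /andP[es st]; rewrite ge_min.
have [st0|t0s] := leP s t0; first by rewrite hd ?es.
apply/orP; right.
have sT : `|T - s| * (2 * N) < D T.
  rewrite -ltr_pdivlMr ?mulr_gt0 //.
  by rewrite ltr_norml; apply/andP; split; lra.
have := Dlip T s.
have : `|T - s| * nrm (y - x) <= `|T - s| * N by rewrite ler_wpM2l // lerDl.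
lra.
Qed.



(** A point of the second segment that is close to [x] lies over a point of the arc
that is close to its origin, hence over a point of the first segment close to [x];
two such points are equal because they differ by a short lattice vector. *)
Lemma lifts_to_parallel A x y y' : lifts_to A x y -> x <> y ->
  pi @` segment x y' = A ->
  exists2 s : R, 0 < s <= 1 & exists2 t : R, 0 <= t <= 1 &
    s *: (y' - x) = t *: (y - x).
Proof.
move=> lift xy imA'; have [imA _] := lift.
have [rho rho0 gap] := lattice_gap.
pose N := nrm (y - x) + 1; pose N' := nrm (y' - x) + 1.
have N0 : 0 < N by rewrite ltr_wpDl ?nrm_ge0.
have N'0 : 0 < N' by rewrite ltr_wpDl ?nrm_ge0.
have NN : nrm (y - x) <= N by rewrite lerDl.
have NN' : nrm (y' - x) <= N' by rewrite lerDl.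
pose eta := Num.min 1 (rho / 2 / N).
have eta0 : 0 < eta by rewrite lt_min ltr01 !divr_gt0.
have eta1 : eta <= 1 by rewrite ge_min lexx.
have etaN : eta * N <= rho / 2 by rewrite -ler_pdivlMr // ge_min lexx orbT.
have [|d d0 hd] := @lifts_to_start_isolated A x y eta lift xy; first by rewrite eta0.
pose c := Num.min (d / 2) (rho / 2).
have c0 : 0 < c by rewrite lt_min !divr_gt0.
have cd : c <= d / 2 by rewrite ge_min lexx.
have cr : c <= rho / 2 by rewrite ge_min lexx orbT.
pose s := Num.min 1 (c / N').
have s0 : 0 < s by rewrite lt_min ltr01 divr_gt0.
have s1 : s <= 1 by rewrite ge_min lexx.
have sN : s * N' <= c by rewrite -ler_pdivlMr // ge_min lexx orbT.
have sn : nrm (s *: (y' - x)) <= c.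
  by rewrite nrmZ gtr0_norm // (le_trans _ sN) // ler_wpM2l // ltW.
exists s; first by rewrite s0.
have : A (pi (x + s *: (y' - x))).
  rewrite -imA'; exists (x + s *: (y' - x)) => //; rewrite segmentE.
  by exists s => //=; rewrite (ltW s0).
rewrite -imA => -[z]; rewrite segmentE => -[t /andP[t0 t1] <-] ts.
exists t; first by rewrite t0.
have tlt : t < eta.
  rewrite ltNge; apply/negP => te; have := hd t; rewrite te t1 => /(_ isT).
  rewrite ts; have := torus_dist_le (x + s *: (y' - x)) x.
  by rewrite addrAC subrr add0r; lra.
have /projP h := ts; apply/esym/eqP; rewrite -subr_eq0; apply/eqP/gap.
  by move: h; rewrite opprD addrACA subrr add0r.
apply: le_lt_trans (nrm_triangle _ _) _; rewrite nrmN nrmZ ger0_norm //.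
have : t * nrm (y - x) <= t * N by rewrite ler_wpM2l.
have : t * N < eta * N by rewrite ltr_pM2r.
lra.
Qed.

(** Two lifts from [x] are parallel, so one contains the other; the end of the
shorter one lies over the end of the longer one, and the longer one is injective. *)
Lemma lifts_to_unique A x y y' : x <> y -> x <> y' -> pi y = pi y' ->
  lifts_to A x y -> lifts_to A x y' -> y = y'.
Proof.
move=> xy xy' yy' lift lift'; have [_ inj] := lift; have [imA' inj'] := lift'.
have [s /andP[s0 s1] [t /andP[t0 t1] st]] := lifts_to_parallel lift xy imA'.
have s0' : s != 0 by rewrite gt_eqF.
have tpos : 0 < t.
  rewrite lt_def t0 andbT; apply/eqP => tz; move: st => /eqP.
  rewrite tz scale0r scaler_eq0 (negPf s0') subr_eq0 /= => /eqP y'x.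
  by apply: xy'.
have t0' : t != 0 by rewrite gt_eqF.
have [ts|/ltW st'] := leP t s.
  have e : y' = x + (t / s) *: (y - x).
    by rewrite mulrC -scalerA -st scalerA mulVf // scale1r addrC subrK.
  apply: inj => //; first exact: segment_right.
  rewrite segmentE e; exists (t / s) => //=.
  by rewrite divr_ge0 ?(ltW s0) //= ler_pdivrMr // mul1r.
have e : y = x + (s / t) *: (y' - x).
  by rewrite mulrC -scalerA st scalerA mulVf // scale1r addrC subrK.
apply: inj' => //; last exact: segment_right.
rewrite segmentE e; exists (s / t) => //=.
by rewrite divr_ge0 ?(ltW s0) //= ler_pdivrMr // mul1r.
Qed.

End Torus.

(** * Two-element sets, bijections and connectedness *)

Lemma sval_inj (T : Type) (P : T -> Prop) : injective (@sval T P).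
Proof.
by move=> [x hx] [y hy] /= xy; subst y; rewrite (Prop_irrelevance hx hy).
Qed.

Lemma exactly_two_other T (A : set T) a b c :
  exactly_two A -> A a -> A b -> A c -> b <> a -> c <> a -> b = c.
Proof.
move=> [x [y [xy ->]]] [->|->] [->|->] [->|->] => // ? ?; exact: False_ind.
Qed.

Lemma exactly_two_ex T (A : set T) a : exactly_two A -> A a ->
  exists2 b, b <> a & A b.
Proof.
move=> [x [y [xy ->]]] [->|->]; [exists y | exists x] => //.
- exact: nesym.
- by right.
- by left.
Qed.

Lemma exactly_two_sval T (P Q : T -> Prop) :
  exactly_two [set a : {x | P x} | Q (sval a)] <->
  exactly_two [set x | P x /\ Q x].
Proof.
split=> [[x [y [xy e]]]|[x [y [xy e]]]].
  exists (sval x), (sval y); split; first by move=> /sval_inj.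
  apply/seteqP; split=> z /=.
    move=> [Pz Qz]; have : [set x; y] (exist _ z Pz) by rewrite -e.
    by case=> [<-|<-]; [left|right].
  have Qx : Q (sval x) by have : [set x; y] x by [left]; rewrite -e.
  have Qy : Q (sval y) by have : [set x; y] y by [right]; rewrite -e.
  by case=> ->; split=> //; apply: svalP.
have [Px Qx] : P x /\ Q x by have : [set x; y] x by [left]; rewrite -e.
have [Py Qy] : P y /\ Q y by have : [set x; y] y by [right]; rewrite -e.
exists (exist _ x Px), (exist _ y Py); split; first by case.
apply/seteqP; split=> [[z Pz] /= Qz|z /=]; last by case=> ->.
have : [set x; y] z by rewrite -e.
by case=> zE; [left|right]; apply: sval_inj.
Qed.

Lemma exactly_two_lift T T' (p : T -> T') (A : set T) (A' : set T') :
  (forall a, A a -> A' (p a)) -> (forall b, A' b -> exists2 a, A a & p a = b) ->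
  (forall a b, A a -> A b -> p a = p b -> a = b) ->
  exactly_two A' -> exactly_two A.
Proof.
move=> pA sur inj [x [y [xy e]]].
have [a Aa ax] : exists2 a, A a & p a = x by apply: sur; rewrite e; left.
have [b Ab bY] : exists2 a, A a & p a = y by apply: sur; rewrite e; right.
exists a, b; split; first by move=> ab; apply: xy; rewrite -ax -bY ab.
apply/seteqP; split=> [c Ac|c]; last by case=> ->.
have : [set x; y] (p c) by rewrite -e; apply: pA.
by rewrite -ax -bY; case=> /inj ->//; [left|right].
Qed.

(** Two injections that agree on one of two elements agree on the other one. *)
Lemma exactly_two_agree T T' (p q : T -> T') (A : set T) (A' : set T') a b :
  injective p -> injective q -> (forall c, A c -> A' (p c)) ->
  (forall c, A c -> A' (q c)) -> exactly_two A' ->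
  A a -> A b -> p a = q a -> p b = q b.
Proof.
move=> pI qI pA qA A2 Aa Ab pq.
have [->|ba] := pselect (b = a); first by [].
apply: (exactly_two_other A2 (pA _ Aa) (pA _ Ab) (qA _ Ab)).
  by move=> /pI.
by rewrite pq => /qI.
Qed.

Lemma clos_rt_sym T (r : T -> T -> Prop) : (forall x y, r x y -> r y x) ->
  forall x y, clos_refl_trans T r x y -> clos_refl_trans T r y x.
Proof.
move=> rs x y; elim=> [a b ab|a|a b c _ ba _ cb]; first by apply/rt_step/rs.
  exact: rt_refl.
exact: rt_trans cb ba.
Qed.

Lemma clos_rt_bij T (h : T -> T) (r s : T -> T -> Prop) : bijective h ->
  (forall x y, s (h x) (h y) <-> r x y) -> forall x y,
  clos_refl_trans T s (h x) (h y) <-> clos_refl_trans T r x y.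
Proof.
move=> [k hk kh] sr x y; split; last first.
  elim=> [a b ab|a|a b c _ ab _ bc]; first by apply/rt_step/sr.
    exact: rt_refl.
  exact: rt_trans ab bc.
suff aux a b : clos_refl_trans T s a b -> clos_refl_trans T r (k a) (k b).
  by move=> /aux; rewrite !hk.
elim=> [{}a {}b ab|{}a|{}a {}b c _ ab _ bc]; first by apply/rt_step/sr; rewrite !kh.
  exact: rt_refl.
exact: rt_trans ab bc.
Qed.

Lemma connected_from (G : graph) (x : node G) :
  (forall y, clos_refl_trans _ (@adjacent G) x y) -> connected_graph G.
Proof.
move=> h; split; first by exists x.
move=> y z; apply: rt_trans (h z); apply: clos_rt_sym (h y).
by move=> a b [e [ea eb]]; exists e.
Qed.

Lemma connected_ind (G : graph) (K : node G -> Prop) x : connected_graph G ->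
  K x -> (forall y z, adjacent y z -> K y -> K z) -> forall y, K y.
Proof.
move=> [_ conn] Kx step y; move: (conn x y) Kx.
by elim=> [a b ab|//|a b c _ ab _ bc] Ka; [apply: step ab Ka | apply/bc/ab].
Qed.

Lemma face_ind (P : prepolyhedron) (f : face P) v0 (K : node P -> Prop) :
  connected_graph (face_graph f) -> fverts f v0 -> K v0 ->
  (forall v v' e, fverts f v -> fverts f v' -> fedges f e -> ends e v ->
     ends e v' -> K v -> K v') ->
  forall v, fverts f v -> K v.
Proof.
move=> conn f0 K0 step v fv.
pose K' (a : node (face_graph f)) := K (sval a).
apply: (@connected_ind _ K' (exist _ v0 f0) conn _ _ (exist _ v fv)) => //.
by move=> [a fa] [b fb] [[e fe] [/= ea eb]] Ka; apply: step ea eb Ka.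
Qed.

Lemma vfig_ind (P : prepolyhedron) (v : node P) e0 (K : arc P -> Prop) :
  connected_graph (vertex_figure v) -> ends e0 v -> K e0 ->
  (forall e e' f, ends e v -> ends e' v -> fverts f v -> fedges f e ->
     fedges f e' -> K e -> K e') ->
  forall e, ends e v -> K e.
Proof.
move=> conn f0 K0 step e ev.
pose K' (a : node (vertex_figure v)) := K (sval a).
apply: (@connected_ind _ K' (exist _ e0 f0) conn _ _ (exist _ e ev)) => //.
by move=> [a fa] [b fb] [[f fe] [/= ea eb]] Ka; apply: step ea eb Ka.
Qed.


Lemma image_bijective T (h : T -> T) : bijective h ->
  bijective (fun A : set T => h @` A).
Proof.
move=> [k hk kh]; exists (fun A => k @` A) => A.
  apply/seteqP; split=> [_ [_ [x Ax <-] <-]|x Ax]; first by rewrite hk.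
  by exists (h x); [exists x | rewrite hk].
apply/seteqP; split=> [_ [_ [x Ax <-] <-]|x Ax]; first by rewrite kh.
by exists (k x); [exists x | rewrite kh].
Qed.

Lemma image_inj_mem T T' (h : T -> T') (A : set T) x : injective h ->
  (h @` A) (h x) <-> A x.
Proof. by move=> hI; split=> [[y Ay /hI <-]|Ax] //; exists x. Qed.

Lemma prod_bijective T T' (h : T -> T) (k : T' -> T') : bijective h ->
  bijective k -> bijective (fun p : T * T' => (h p.1, k p.2)).
Proof.
move=> [h' hh' h'h] [k' kk' k'k]; exists (fun p => (h' p.1, k' p.2)) => -[a b] /=.
  by rewrite hh' kk'.
by rewrite h'h k'k.
Qed.

Definition sub_map T (P : T -> Prop) (h : T -> T) (hP : forall x, P (h x) <-> P x)
    (a : {x | P x}) : {x | P x} :=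
  exist _ (h (sval a)) ((hP (sval a)).2 (svalP a)).

Lemma sub_map_bijective T (P : T -> Prop) h (hP : forall x, P (h x) <-> P x) :
  bijective h -> bijective (sub_map hP).
Proof.
move=> [k hk kh].
have kP x : P (k x) <-> P x by rewrite -hP kh.
exists (sub_map kP) => -[x Px]; apply: sval_inj => /=; [exact: hk | exact: kh].
Qed.


(** * Rigidity of automorphisms *)

Section Rigidity.
Variable P : prepolyhedron.
Hypothesis polyP : is_polyhedron P.

Lemma edges_of_face_at f v : fverts f v ->
  exactly_two [set e : arc P | fedges f e /\ ends e v].
Proof.
by move=> fv; apply/exactly_two_sval; exact: (face_two_valent polyP (exist _ v fv)).
Qed.

Lemma faces_of_edge_at e v : ends e v ->
  exactly_two [set f : face P | fverts f v /\ fedges f e].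
Proof.
by move=> ev; apply/exactly_two_sval; exact: (vfig_two_valent polyP (exist _ e ev)).
Qed.

Lemma flag_exists : exists v e f, @is_flag P v e f.
Proof.
have [[v _] _] := skel_connected polyP; have [[[e ev] _] _] := vfig_connected polyP v.
have [f [f' [_ E]]] := faces_of_edge_at ev.
have [fv fe] : fverts f v /\ fedges f e.
  by have : [set f : face P | fverts f v /\ fedges f e] f by rewrite E; left.
by exists v, e, f.
Qed.

Section Agree.
Variables phi psi : automorphism P.

Let agree_at v e := [/\ on_vert phi v = on_vert psi v,
  on_edge phi e = on_edge psi e &
  forall f, fverts f v -> fedges f e -> on_face phi f = on_face psi f].

(** An edge and one of its two faces at [v] determine the other face, and a face and
one of its two edges at [v] determine the other edge. The agreement of two
automorphisms thus spreads around the vertex, by connectedness of the vertex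
figure. *)
Lemma automorphism_rigid_at v e f : is_flag v e f ->
  on_vert phi v = on_vert psi v -> on_edge phi e = on_edge psi e ->
  on_face phi f = on_face psi f -> forall e', ends e' v -> agree_at v e'.
Proof.
move=> [ev fe fv] pv pe pf.
have other_face e' f' : ends e' v -> on_edge phi e' = on_edge psi e' ->
    fedges f' e' -> fverts f' v -> on_face phi f' = on_face psi f' -> agree_at v e'.
  move=> ev' pe' fe' fv' pf'; split=> // f'' fv'' fe''.
  have ev2 : ends (on_edge phi e') (on_vert phi v) by apply/on_ends.
  apply: (exactly_two_agree (A := [set f | fverts f v /\ fedges f e'])
    (bij_inj (on_face_bij phi)) (bij_inj (on_face_bij psi))
    _ _ (faces_of_edge_at ev2) (conj fv' fe') (conj fv'' fe'') pf').
    by move=> c [cv ce]; split; [apply/on_fverts | apply/on_fedges].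
  by move=> c [cv ce]; rewrite pv pe'; split; [apply/on_fverts | apply/on_fedges].
apply: (vfig_ind (vfig_connected polyP v) ev).
  exact: other_face fe fv pf.
move=> e1 e2 f1 ev1 ev2 fv1 fe1 fe2 [_ pe1 /(_ _ fv1 fe1) pf1].
apply: (other_face e2 f1) => //.
have fv3 : fverts (on_face phi f1) (on_vert phi v) by apply/on_fverts.
apply: (exactly_two_agree (A := [set e | fedges f1 e /\ ends e v])
    (bij_inj (on_edge_bij phi)) (bij_inj (on_edge_bij psi))
    _ _ (edges_of_face_at fv3) (conj fe1 ev1) (conj fe2 ev2) pe1).
  by move=> c [cv ce]; split; [apply/on_fedges | apply/on_ends].
by move=> c [cv ce]; rewrite pv pf1; split; [apply/on_fedges | apply/on_ends].
Qed.

(** The agreement at a vertex passes to the other end of each of its edges, since an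
edge has two ends, and spreads to all vertices by connectedness of the skeleton. *)
Lemma automorphism_rigid v e f : is_flag v e f ->
  on_vert phi v = on_vert psi v -> on_edge phi e = on_edge psi e ->
  on_face phi f = on_face psi f ->
  [/\ on_vert phi = on_vert psi, on_edge phi = on_edge psi &
      on_face phi = on_face psi].
Proof.
move=> fl pv pe pf.
have all_agree v' : forall e', ends e' v' -> agree_at v' e'.
  apply: (@connected_ind _ (fun v' => forall e', ends e' v' -> agree_at v' e') v
    (skel_connected polyP)); first exact: automorphism_rigid_at fl pv pe pf.
  move=> v1 v2 [e1 [ev1 ev2]] /(_ _ ev1) [pv1 pe1 pf1].
  have [f1 fe1] := edge_in_face polyP e1.
  have fv1 := face_subgraph polyP fe1 ev1.
  have fv2 := face_subgraph polyP fe1 ev2.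
  apply: (@automorphism_rigid_at v2 e1 f1); rewrite ?pf1 //.
  apply: (exactly_two_agree (A := ends e1) (bij_inj (on_vert_bij phi)) (bij_inj (on_vert_bij psi))
    _ _ (skel_proper polyP (on_edge phi e1)) ev1 ev2 pv1).
    by move=> c cv; apply/on_ends.
  by move=> c cv; rewrite pe1; apply/on_ends.
split; apply/funext.
- move=> v'; have [[[e' ev'] _] _] := vfig_connected polyP v'.
  by have [] := all_agree v' e' ev'.
- move=> e'; have [v' [w' [_ E]]] := skel_proper polyP e'.
  have ev' : ends e' v' by rewrite E; left.
  by have [] := all_agree v' e' ev'.
- move=> f'; have [[[v' fv'] _] _] := face_connected polyP f'.
  have [e' [e'' [_ E]]] := edges_of_face_at fv'.
  have [fe' ev'] : fedges f' e' /\ ends e' v'.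
    by have : [set e : arc P | fedges f' e /\ ends e v'] e' by rewrite E; left.
  by have [_ _ /(_ _ fv' fe')] := all_agree v' e' ev'.
Qed.

End Agree.
End Rigidity.

(** * The lifted polyhedron *)

Section LiftedPolyhedron.
Variables (R : realType) (L : lattice R) (PL : realized (torus L)).
Hypothesis regPL : regular_in_torus PL.
Notation pi := (@proj R L).
Notation td := (@torus_dist R L).
Notation reach := (clos_refl_trans (E3 R)).
Implicit Types (x y z : E3 R) (v w : node PL) (e : arc PL) (f : face PL).

Lemma PL_polyhedron : is_polyhedron PL.
Proof. by case: regPL => -[]. Qed.

Lemma rvert_inj : injective (rvert PL).
Proof. by case: regPL => _ []. Qed.

Lemma redge_inj : injective (redge PL).
Proof. by case: regPL => _ []. Qed.

Lemma rface_inj : injective (rface PL).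
Proof. by case: regPL => _ []. Qed.

(** [lifts e] is the adjacency of the covering graph of the skeleton by edges
over [e]. *)
Definition lifts e x y : Prop :=
  (exists v w, [/\ v <> w, ends e v, ends e w, pi x = rvert PL v &
     pi y = rvert PL w]) /\ lifts_to (redge PL e) x y.

Lemma lifts_sym e x y : lifts e x y -> lifts e y x.
Proof.
move=> [[v [w [vw ev ew xv yw]]] /lifts_to_sym h]; split=> //.
by exists w, v; split=> // wv; apply: vw.
Qed.

Lemma lifts_exists e x v : ends e v -> pi x = rvert PL v -> exists y, lifts e x y.
Proof.
move=> ev xv; have [w wv ew] := exactly_two_ex (skel_proper PL_polyhedron e) ev.
have [_ _ _ [geo _] _] := regPL.
have [y yw h] := geodesic_lift (geo e v w (nesym wv) ev ew) xv.
by exists y; split=> //; exists v, w; split=> // vw; apply: wv.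
Qed.

Lemma lifts_neq e x y : lifts e x y -> x <> y.
Proof.
move=> [[v [w [vw _ _ xv yw]]] _] xy; apply: vw.
by apply: rvert_inj; rewrite -xv -yw xy.
Qed.

Lemma lifts_unique e x y y' : lifts e x y -> lifts e x y' -> y = y'.
Proof.
move=> l l'; apply: (lifts_to_unique (lifts_neq l) (lifts_neq l') _ l.2 l'.2).
case: l l' => -[v [w [vw ev ew xv yw]]] _ [[v' [w' [vw' ev' ew' xv' yw']]] _].
have vv' : v' = v by apply: rvert_inj; rewrite -xv -xv'.
rewrite yw yw'; congr rvert; subst v'.
exact: (exactly_two_other (skel_proper PL_polyhedron e) ev ew ew' (nesym vw) (nesym vw')).
Qed.

Lemma lifts_ends e x y v : lifts e x y -> pi x = rvert PL v -> ends e v.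
Proof.
move=> [[v' [w [vw ev ew xv yw]]] _] xv'.
by have <- : v' = v by apply: rvert_inj; rewrite -xv -xv'.
Qed.

(** A lifted edge meets the points over vertices only at its ends, because an edge
of the torus graph has no vertex in its interior and the lift is injective. A
lifted edge can therefore be represented by its segment alone. *)
Lemma lifts_vertex e x y z v : lifts e x y -> segment x y z -> pi z = rvert PL v ->
  z = x \/ z = y.
Proof.
move=> [[v' [w [vw ev ew xv yw]]] [im inj]] sz zv.
have [_ _ _ [_ noint] _] := regPL.
have evz : ends e v by apply: noint; rewrite -im -zv; exists z.
have [vv'|vv'] := pselect (v = v').
  by left; apply: inj => //; [exact: segment_left | rewrite zv xv vv'].
right; apply: inj => //; first exact: segment_right.
rewrite zv yw; congr rvert.
exact: (exactly_two_other (skel_proper PL_polyhedron e) ev evz ew vv' (nesym vw)).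
Qed.

Variables (x0 : E3 R) (v0 : node PL).
Hypothesis x0v0 : pi x0 = rvert PL v0.

Definition step x y : Prop := exists e, lifts e x y.
Definition fstep f x y : Prop := exists2 e, fedges f e & lifts e x y.

Lemma step_sym x y : step x y -> step y x.
Proof. by move=> [e /lifts_sym]; exists e. Qed.

Lemma fstep_sym f x y : fstep f x y -> fstep f y x.
Proof. by move=> [e fe /lifts_sym]; exists e. Qed.

Lemma reach_vertex x : reach step x0 x -> exists v, pi x = rvert PL v.
Proof.
move=> /clos_rt_rtn1_iff; case=> [|y z [e [[v [w [_ _ _ _ zw]]] _]] _].
  by exists v0.
by exists w.
Qed.

Lemma freach_reach f x y : reach (fstep f) x y -> reach step x y.
Proof.
elim=> [a b [e _ h]|a|a b c _ ab _ bc]; first by apply: rt_step; exists e.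
  exact: rt_refl.
exact: rt_trans ab bc.
Qed.

Lemma freach_fverts f x v y w : reach (fstep f) x y -> fverts f v ->
  pi x = rvert PL v -> pi y = rvert PL w -> fverts f w.
Proof.
move=> /clos_rt_rtn1_iff; case=> [fv -> /rvert_inj <- //|{}y z [e fe /lifts_sym h] _ _ _ zw].
exact: (face_subgraph PL_polyhedron fe (lifts_ends h zw)).
Qed.

(** The edges and faces of the covering carry the edge or face that they cover, so
that incidences can be read in the torus; a face is represented by its set of
vertices, a component of the preimage of the face that it covers. *)
Definition lnode : Type := {x : E3 R | reach step x0 x}.
Definition larc : Type := {eA : arc PL * set (E3 R) |
  exists x y, [/\ reach step x0 x, lifts eA.1 x y & eA.2 = segment x y]}.
Definition lface : Type := {fK : face PL * set (E3 R) |
  exists x v, [/\ reach step x0 x, pi x = rvert PL v, fverts fK.1 v &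
    fK.2 = [set y | reach (fstep fK.1) x y]]}.

Definition lifted_graph : graph :=
  @Graph lnode larc (fun a p => (sval a).2 (sval p)).

Definition lifted_prepolyhedron : prepolyhedron :=
  @PrePolyhedron lifted_graph lface
    (fun g p => (sval g).2 (sval p))
    (fun g a => fedges (sval g).1 (sval a).1 /\
       exists p : lnode, (sval g).2 (sval p) /\ (sval a).2 (sval p)).

Definition lifted : realized (E3 R) :=
  @Realized _ lifted_prepolyhedron (fun p => sval p) (fun a => (sval a).2).

Implicit Types (X Y : node lifted) (a b : arc lifted) (g h : face lifted).

Lemma lnode_vertex X : exists v, pi (sval X) = rvert PL v.
Proof. exact: reach_vertex (svalP X). Qed.

Lemma larc_at a X : ends a X ->
  exists2 y, lifts (sval a).1 (sval X) y & (sval a).2 = segment (sval X) y.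
Proof.
case: a => -[e A] /= [x [y [_ /= l ->]]] aX; have [v Xv] := lnode_vertex X.
have [->|->] := lifts_vertex l aX Xv; first by exists y.
by exists x; [exact: lifts_sym | rewrite segment_sym].
Qed.

Lemma lifts_reach e x y : lifts e x y -> reach step x0 x -> reach step x0 y.
Proof. by move=> l xr; apply: rt_trans xr _; apply: rt_step; exists e. Qed.

Lemma larc_at_node a X : ends a X -> exists Y, [/\ Y <> X,
  lifts (sval a).1 (sval X) (sval Y) & (sval a).2 = segment (sval X) (sval Y)].
Proof.
move=> /larc_at [y l E]; exists (exist _ y (lifts_reach l (svalP X))); split=> //.
by move=> yX; apply: (lifts_neq l); rewrite -yX.
Qed.

Lemma larc_over a X v : ends a X -> pi (sval X) = rvert PL v -> ends (sval a).1 v.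
Proof. by move=> /larc_at [y l _]; apply: lifts_ends l. Qed.

Lemma larc_inj a b X : ends a X -> ends b X -> (sval a).1 = (sval b).1 -> a = b.
Proof.
move=> /larc_at [y l E] /larc_at [z l' E'] ab; apply: sval_inj.
rewrite -ab in l'; rewrite (lifts_unique l l') -E' in E.
by case: (sval a) (sval b) ab E => ? ? [? ?] /= -> ->.
Qed.

Lemma larc_exists X v e : pi (sval X) = rvert PL v -> ends e v ->
  exists2 a, ends a X & (sval a).1 = e.
Proof.
move=> Xv ev; have [y l] := lifts_exists ev Xv.
have aP : exists x' y', [/\ reach step x0 x', lifts e x' y' &
    segment (sval X) y = segment x' y'].
  by exists (sval X), y; split=> //; apply: svalP.
by exists (exist _ (e, segment (sval X) y) aP) => //=; apply: segment_left.
Qed.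

Lemma larc_end a X Y Z : Y <> X -> ends a X -> ends a Y -> ends a Z -> Z = X \/ Z = Y.
Proof.
move=> YX aX aY aZ; have [y l E] := larc_at aX.
have aE W : ends a W -> sval W = sval X \/ sval W = y.
  have [w Ww] := lnode_vertex W; rewrite /= E => s; exact: lifts_vertex l s Ww.
have [/sval_inj|Yy] := aE _ aY; first by [].
have [/sval_inj|Zy] := aE _ aZ; first by left.
by right; apply: sval_inj; rewrite Yy Zy.
Qed.

Lemma larc_ends a : exists X Y, [/\ Y <> X, ends a X, ends a Y,
  lifts (sval a).1 (sval X) (sval Y) & (sval a).2 = segment (sval X) (sval Y)].
Proof.
have [x [y [xr l E]]] := svalP a; pose X : node lifted := exist _ x xr.
have aX : ends a X by rewrite /= E; exact: segment_left.
have [Y [YX lY EY]] := larc_at_node aX; exists X, Y; split=> //.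
by rewrite /= EY; exact: segment_right.
Qed.

Lemma lface_at g X : fverts g X ->
  (sval g).2 = [set y | reach (fstep (sval g).1) (sval X) y].
Proof.
case: g => -[f K] /= [x [v [xr xv /= fv ->]]] /= xX.
have Xx := clos_rt_sym (@fstep_sym f) xX.
by apply/seteqP; split=> z /= h; [apply: rt_trans Xx h | apply: rt_trans xX h].
Qed.

Lemma lface_over g X v : fverts g X -> pi (sval X) = rvert PL v ->
  fverts (sval g).1 v.
Proof.
case: g => -[f K] /= [x [w [xr xv /= fv ->]]] /= xX Xv.
exact: freach_fverts xX fv xv Xv.
Qed.

Lemma lface_inj g h X : fverts g X -> fverts h X -> (sval g).1 = (sval h).1 ->
  g = h.
Proof.
move=> /lface_at E /lface_at E' gh; apply: sval_inj; rewrite -gh -E in E'.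
by case: (sval g) (sval h) gh E' => ? ? [? ?] /= -> ->.
Qed.

Lemma lface_exists X v f : pi (sval X) = rvert PL v -> fverts f v ->
  exists2 g, fverts g X & (sval g).1 = f.
Proof.
move=> Xv fv; pose K := [set y | reach (fstep f) (sval X) y].
have gP : exists x v, [/\ reach step x0 x, pi x = rvert PL v, fverts f v &
    K = [set y | reach (fstep f) x y]].
  by exists (sval X), v; split=> //; apply: svalP.
by exists (exist _ (f, K) gP) => //=; apply: rt_refl.
Qed.

Lemma lface_step g X Y : fverts g X -> fstep (sval g).1 (sval X) (sval Y) ->
  fverts g Y.
Proof. by move=> /lface_at E s; rewrite /= E /=; apply: rt_step. Qed.

Lemma lfedges_fverts g a X : fedges g a -> ends a X -> fverts g X.
Proof.
move=> [fe [Z [gZ aZ]]] aX; have [->//|XZ] := pselect (X = Z).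
have [Y [YZ l E]] := larc_at_node aZ.
have aY : ends a Y by rewrite /= E; exact: segment_right.
have [|->] := larc_end YZ aZ aY aX; first by [].
by apply: (lface_step gZ); exists (sval a).1.
Qed.

Lemma lfedges_at g a X : ends a X ->
  fedges g a <-> fverts g X /\ fedges (sval g).1 (sval a).1.
Proof.
move=> aX; split; first by move=> ga; split; [exact: lfedges_fverts ga aX | case: ga].
by move=> [gX fe]; split=> //; exists X.
Qed.

(** At each point [X] over a vertex [v], the maps to the torus are bijective from the
edges and faces at [X] to those at [v] and preserve incidence, so that the local
axioms are inherited. Connectedness of the skeleton and of the faces holds because
they were taken as components. *)
Lemma lifted_polyhedron : is_polyhedron lifted.
Proof.
split.
- move=> a; have [X [Y [YX aX aY _ _]]] := larc_ends a.
  exists X, Y; split; first exact: nesym.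
  by apply/seteqP; split=> [Z aZ|Z [->|->] //]; exact: larc_end YX aX aY aZ.
- pose X0 : node lifted := exist _ x0 (rt_refl _ _ _).
  apply: (@connected_from lifted X0) => -[x xr].
  move: (xr); move/clos_rt_rtn1_iff: (xr) => h.
  elim: {x xr} h => [|y z [e l] /clos_rt_rtn1_iff yr IH] xr.
    by rewrite (_ : exist _ _ _ = X0); [exact: rt_refl | exact: sval_inj].
  apply: rt_trans (IH yr) _; apply: rt_step.
  have [v yv] := reach_vertex yr.
  have [a aY ae] := @larc_exists (exist _ y yr) v e yv (lifts_ends l yv).
  exists a; split=> //; have [t la E] := larc_at aY.
  by rewrite /= E (lifts_unique l (_ : lifts e _ t)) -?ae //; exact: segment_right.
- by move=> g a ga X aX; exact: lfedges_fverts ga aX.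
- move=> a; have [X [Y [_ aX _ _ _]]] := larc_ends a; have [v Xv] := lnode_vertex X.
  have [f fe] := edge_in_face PL_polyhedron (sval a).1.
  have fv := face_subgraph PL_polyhedron fe (larc_over aX Xv).
  have [g gX gf] := lface_exists Xv fv; exists g; apply/(lfedges_at _ aX).
  by rewrite gf.
- move=> g; have [x [v [xr xv fv E]]] := svalP g.
  have gx : fverts g (exist _ x xr : node lifted) by rewrite /= E; exact: rt_refl.
  pose X0 : node (face_graph g) := exist _ (exist _ x xr) gx.
  apply: (@connected_from (face_graph g) X0) => -[[y yr] gy].
  move: (yr) (gy); rewrite /= E /= in gy.
  move/clos_rt_rtn1_iff: gy => h.
  elim: {y yr} h => [|y z [e fe l] /clos_rt_rtn1_iff yx IH] zr gz.
    rewrite (_ : exist _ _ _ = X0); first exact: rt_refl.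
    by apply: sval_inj; apply: sval_inj.
  have yr : reach step x0 y by apply: rt_trans xr (freach_reach yx).
  have gy : fverts g (exist _ y yr : node lifted) by rewrite /= E.
  apply: rt_trans (IH yr gy) _; apply: rt_step.
  have [w yw] := reach_vertex yr.
  have [a aY ae] := @larc_exists (exist _ y yr) w e yw (lifts_ends l yw).
  have ga : fedges g a by apply/(lfedges_at _ aY); rewrite ae.
  exists (exist _ a ga); split=> //; have [t la Ea] := larc_at aY.
  by rewrite /= Ea (lifts_unique l (_ : lifts e _ t)) -?ae //; exact: segment_right.
- move=> g [X gX].
  refine ((exactly_two_sval (fun a : arc lifted => fedges g a) (fun a => ends a X)).2 _).
  have [v Xv] := lnode_vertex X.
  have fv := lface_over gX Xv.
  apply: (exactly_two_lift (p := fun a : arc lifted => (sval a).1) _ _ _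
    (edges_of_face_at PL_polyhedron fv)).
  + move=> a [ga aX]; split; last exact: larc_over aX Xv.
    by move/(lfedges_at g aX): ga => [].
  + move=> e [fe ev]; have [a aX ae] := larc_exists Xv ev; exists a => //.
    by split=> //; apply/(lfedges_at g aX); rewrite ae.
  + by move=> a b [_ aX] [_ bX]; exact: larc_inj aX bX.
- move=> X; have [v Xv] := lnode_vertex X.
  have [[[e0 ev0] _] _] := vfig_connected PL_polyhedron v.
  have [a0 aX0 ae0] := larc_exists Xv ev0.
  apply: (@connected_from (vertex_figure X) (exist _ a0 aX0)) => -[a aX].
  pose K e := forall a (aX : ends a X), (sval a).1 = e ->
    clos_refl_trans _ (@adjacent (vertex_figure X)) (exist _ a0 aX0) (exist _ a aX).
  apply: (@vfig_ind _ v e0 K (vfig_connected PL_polyhedron v) ev0 _ _ (sval a).1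
    (larc_over aX Xv)) => //.
    move=> b bX be; rewrite (_ : exist _ _ _ = exist _ a0 aX0); first exact: rt_refl.
    by apply: sval_inj; apply: (larc_inj bX aX0); rewrite be ae0.
  move=> e1 e2 f ev1 ev2 fv fe1 fe2 Ke1 b bX be.
  have [a1 aX1 ae1] := larc_exists Xv ev1; have [g gX gf] := lface_exists Xv fv.
  apply: rt_trans (Ke1 a1 aX1 ae1) _; apply: rt_step; exists (exist _ g gX).
  by split; [apply/(lfedges_at g aX1) | apply/(lfedges_at g bX)]; rewrite gf ?ae1 ?be.
- move=> X [a aX].
  apply: (exactly_two_sval (fun g : face lifted => fverts g X) (@fedges lifted^~ a)).2.
  have [v Xv] := lnode_vertex X.
  apply: (exactly_two_lift (p := fun g : face lifted => (sval g).1) _ _ _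
    (faces_of_edge_at PL_polyhedron (larc_over aX Xv))).
  + move=> g [gX ga]; split; first exact: lface_over gX Xv.
    by case: ga.
  + move=> f [fv fe]; have [g gX gf] := lface_exists Xv fv; exists g => //.
    by split=> //; apply/(lfedges_at g aX); rewrite gf.
  + by move=> g h [gX _] [hX _]; exact: lface_inj gX hX.
Qed.

End LiftedPolyhedron.

(** * Realization and symmetry of the lifted polyhedron *)

Section LiftedSymmetry.
Variables (R : realType) (L : lattice R) (PL : realized (torus L)).
Hypothesis regPL : regular_in_torus PL.
Notation pi := (@proj R L).
Notation td := (@torus_dist R L).
Notation reach := (clos_refl_trans (E3 R)).
Implicit Types (x y z : E3 R) (v w : node PL) (e : arc PL) (f : face PL).

Variables (x0 : E3 R) (v0 : node PL).
Hypothesis x0v0 : pi x0 = rvert PL v0.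
Notation lifted := (@lifted R L PL x0).
Notation step := (@step R L PL).
Notation fstep := (@fstep R L PL).
Implicit Types (X Y : node lifted) (a b : arc lifted) (g h : face lifted).

Let PL_polyhedron := PL_polyhedron regPL.

Lemma image_redge a : pi @` redge lifted a = redge PL (sval a).1.
Proof. by case: a => -[e A] /= [x [y [_ /= [_ [<- _]] ->]]]. Qed.

(** The paths of the connected skeleton of the torus polyhedron lift to paths from
[x0]. *)
Lemma lnode_onto v : exists X, pi (sval X) = rvert PL v.
Proof.
apply: (@connected_ind _ (fun v => exists X, pi (sval X) = rvert PL v) v0
  (skel_connected PL_polyhedron)).
  by exists (exist _ x0 (rt_refl _ _ _)).
move=> v1 v2 [e [ev1 ev2]] [X Xv1].
have [y l] := lifts_exists regPL ev1 Xv1.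
have [yv|yv] := pselect (pi y = rvert PL v2).
  by exists (exist _ y (lifts_reach l (svalP X))).
exists X; rewrite Xv1; congr rvert.
case: l => -[u [w [uw ev ew Xv yw]]] _.
have uv1 : u = v1 by apply: (rvert_inj regPL); rewrite -Xv1 -Xv.
subst u; have [//|v12] := pselect (v1 = v2).
case: yv; rewrite yw; congr rvert.
exact: (exactly_two_other (skel_proper PL_polyhedron e) ev1 ew ev2 (nesym uw) (nesym v12)).
Qed.

(** The component [g] covers the whole face, since paths in the connected face lift
to paths in [g]. *)
Lemma image_rface g : [set pi @` A | A in rface lifted g] = rface PL (sval g).1.
Proof.
apply/seteqP; split=> [_ [_ [a [fa _] <-] <-]|_ [e fe <-]].
  by rewrite image_redge; exists (sval a).1.
have [[[X gX] _] _] := face_connected (lifted_polyhedron regPL x0v0) g.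
have [v Xv] := lnode_vertex x0v0 X; have fv := lface_over regPL gX Xv.
have [w [w' [_ E]]] := skel_proper PL_polyhedron e; have ew : ends e w by rewrite E; left.
have fw := face_subgraph PL_polyhedron fe ew.
suff [Y gY Yw] : exists2 Y, fverts g Y & pi (sval Y) = rvert PL w.
  have [a aY ae] := larc_exists regPL Yw ew.
  exists (redge lifted a); last by rewrite image_redge ae.
  by exists a => //; apply/(lfedges_at regPL x0v0 _ aY); rewrite ae.
apply: (@face_ind _ _ v (fun w => exists2 Y, fverts g Y & pi (sval Y) = rvert PL w)
  (face_connected PL_polyhedron (sval g).1)) => //.
  by exists X.
move=> v1 v2 e' fv1 fv2 fe' ev1 ev2 [Y gY Yv1].
have [->|v12] := pselect (v2 = v1); first by exists Y.
have [a aY ae] := larc_exists regPL Yv1 ev1.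
have [Z [ZY l EZ]] := larc_at_node regPL x0v0 aY.
rewrite ae in l.
exists Z; first by apply: (lface_step gY); exists e'.
case: l => -[u [u' [uu' eu eu' Yu Zu']]] _.
have uv1 : u = v1 by apply: (rvert_inj regPL); rewrite -Yv1 -Yu.
subst u; rewrite Zu'; congr rvert.
exact: (exactly_two_other (skel_proper PL_polyhedron e') ev1 eu' ev2 (nesym uu') v12).
Qed.

Lemma lifted_projects_onto : projects_onto lifted PL.
Proof.
split; apply/seteqP; split.
- move=> _ [_ [X _ <-] <-]; have [v Xv] := lnode_vertex x0v0 X.
  by exists v => //=; rewrite -Xv.
- move=> _ [v _ <-]; have [X Xv] := lnode_onto v.
  by exists (sval X) => //; exists X.
- by move=> _ [_ [a _ <-] <-]; rewrite image_redge; exists (sval a).1.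
- move=> _ [e _ <-]; have [v [w [_ E]]] := skel_proper PL_polyhedron e.
  have ev : ends e v by rewrite E; left.
  have [X Xv] := lnode_onto v; have [a aX ae] := larc_exists regPL Xv ev.
  by exists (redge lifted a); [exists a | rewrite image_redge ae].
- by move=> _ [_ [g _ <-] <-]; rewrite image_rface; exists (sval g).1.
- move=> _ [f _ <-]; have [[[v fv] _] _] := face_connected PL_polyhedron f.
  have [X Xv] := lnode_onto v; have [g gX gf] := lface_exists Xv fv.
  by exists (rface lifted g); [exists g | rewrite image_rface gf].
Qed.

Lemma lifted_faithful : faithful lifted.
Proof.
have eI a b : redge lifted a = redge lifted b -> a = b.
  move=> ab; have abe : (sval a).1 = (sval b).1.
    by apply: (redge_inj regPL); rewrite -!image_redge ab.
  have [X [Y [_ aX _ _ _]]] := larc_ends regPL x0v0 a.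
  apply: (larc_inj regPL x0v0 aX _ abe).
  by rewrite /= -[(sval b).2]/(redge lifted b) -ab.
split=> //; first exact: sval_inj.
move=> g h gh; have ghf : (sval g).1 = (sval h).1.
  by apply: (rface_inj regPL); rewrite -!image_rface gh.
have polyP := lifted_polyhedron regPL x0v0.
have [[[X gX] _] _] := face_connected polyP g.
have [a [b [_ E]]] := edges_of_face_at polyP gX.
have [ga aX] : fedges g a /\ ends a X.
  by have : [set a : arc lifted | fedges g a /\ ends a X] a by rewrite E; left.
have : rface lifted h (redge lifted a) by rewrite -gh; exists a.
move=> [c hc /eI ca]; subst c.
exact: (lface_inj gX (lfedges_fverts regPL x0v0 hc aX) ghf).
Qed.

(** Near a point [x], points over vertices lie over the same point of the torus as
[x] by discreteness of the vertex set, hence are equal to [x] by the lattice gap. *)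
Lemma lifted_discrete : discrete (@edist R) (range (rvert lifted)).
Proof.
move=> x; have [rho rho0 gap] := lattice_gap L.
have [_ _ disc _ _] := regPL; have [eps eps0 hd] := disc (pi x).
exists (Num.min eps rho); first by rewrite lt_min eps0.
move=> _ [X _ <-]; rewrite lt_min edistE => /andP[xe xr].
have [v Xv] := lnode_vertex x0v0 X.
apply/esym/(proj_inj_near gap _ xr)/esym/hd; first by exists v.
exact: le_lt_trans (torus_dist_le _ _ _) xe.
Qed.

Lemma lifted_segments a X Y : X <> Y -> ends a X -> ends a Y ->
  redge lifted a = segment (rvert lifted X) (rvert lifted Y).
Proof.
move=> XY aX aY; have [Z [ZX l E]] := larc_at_node regPL x0v0 aX.
have aZ : ends a Z by rewrite /= E; exact: segment_right.
have [YX|->] := larc_end regPL x0v0 ZX aX aZ aY; first by case: XY.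
exact: E.
Qed.

(** An isometry [t] of the torus realizes the automorphism [phi], and its lift [s] to
E^3 maps one vertex of [lifted] to another one. *)
Section Symmetry.
Variables (phi : automorphism PL) (t : torus L -> torus L) (s : E3 R -> E3 R).
Hypothesis t_bij : bijective t.
Hypothesis t_phi : induced_by phi t.
Hypothesis s_bij : bijective s.
Hypothesis s_proj : forall x, pi (s x) = t (pi x).
Hypothesis s_segment : forall x y, s @` segment x y = segment (s x) (s y).
Variables (X1 X2 : node lifted).
Hypothesis s_X1 : s (sval X1) = sval X2.

Lemma vertex_symmetry x v : pi (s x) = rvert PL (on_vert phi v) <-> pi x = rvert PL v.
Proof.
have [tv _ _] := t_phi; rewrite s_proj tv; split=> [|-> //].
exact: bij_inj.
Qed.

Lemma lifts_to_symmetry e x y :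
  lifts_to (redge PL (on_edge phi e)) (s x) (s y) <-> lifts_to (redge PL e) x y.
Proof.
have [_ te _] := t_phi; rewrite te /lifts_to -s_segment.
have -> : pi @` (s @` segment x y) = t @` (pi @` segment x y).
  apply/seteqP; split=> [_ [_ [z xz <-] <-]|_ [_ [z xz <-] <-]].
    by exists (pi z); [exists z | rewrite s_proj].
  by exists (s z); [exists z | rewrite s_proj].
split=> -[im inj]; split.
- exact: (bij_inj (image_bijective t_bij)) im.
- move=> z w xz xw zw; apply: (bij_inj s_bij).
  by apply: inj; [exists z | exists w | rewrite !s_proj zw].
- by rewrite im.
- move=> _ _ [z xz <-] [w xw <-]; rewrite !s_proj => /(bij_inj t_bij) zw.
  by congr s; apply: inj.
Qed.

Lemma lifts_symmetry e x y : lifts (on_edge phi e) (s x) (s y) <-> lifts e x y.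
Proof.
split=> -[[v [w [vw ev ew xv yw]]] /lifts_to_symmetry l]; split=> //.
  have [k ok ko] := on_vert_bij phi.
  exists (k v), (k w); split.
  - by move=> /(bij_inj (Bijective ko ok)).
  - by apply/(on_ends phi); rewrite ko.
  - by apply/(on_ends phi); rewrite ko.
  - by apply/vertex_symmetry; rewrite ko.
  - by apply/vertex_symmetry; rewrite ko.
exists (on_vert phi v), (on_vert phi w); split.
- by move=> /(bij_inj (on_vert_bij phi)).
- exact/on_ends.
- exact/on_ends.
- exact/vertex_symmetry.
- exact/vertex_symmetry.
Qed.

Lemma step_symmetry x y : step (s x) (s y) <-> step x y.
Proof.
split=> -[e]; last by move=> /lifts_symmetry; exists (on_edge phi e).
have [k ok ko] := on_edge_bij phi.
by rewrite -(ko e) => /lifts_symmetry; exists (k e).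
Qed.

Lemma fstep_symmetry f x y : fstep (on_face phi f) (s x) (s y) <-> fstep f x y.
Proof.
split=> -[e fe]; last first.
  by move=> /lifts_symmetry; exists (on_edge phi e) => //; apply/on_fedges.
have [k ok ko] := on_edge_bij phi; move: fe.
rewrite -(ko e) => /on_fedges fe /lifts_symmetry; exists (k e) => //.
Qed.

(** The lift permutes the components of the covering graph; as it maps a point of
the component of [x0] to a point of the same component, it preserves it. *)
Lemma reach_symmetry x : reach step x0 (s x) <-> reach step x0 x.
Proof.
have sym := clos_rt_sym (@step_sym _ _ PL).
have stepP := clos_rt_bij s_bij step_symmetry.
have r1 := svalP X1; have r2 := svalP X2; rewrite -s_X1 in r2.
split=> h.
  by apply: rt_trans r1 _; apply/stepP; apply: rt_trans (sym _ _ r2) h.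
by apply: rt_trans r2 _; apply/stepP; apply: rt_trans (sym _ _ r1) h.
Qed.

Let s_edge (eA : arc PL * set (E3 R)) := (on_edge phi eA.1, s @` eA.2).
Let s_face (fK : face PL * set (E3 R)) := (on_face phi fK.1, s @` fK.2).

Lemma larc_symmetry eA :
  (exists x y, [/\ reach step x0 x, lifts (s_edge eA).1 x y &
     (s_edge eA).2 = segment x y]) <->
  (exists x y, [/\ reach step x0 x, lifts eA.1 x y & eA.2 = segment x y]).
Proof.
split=> -[x [y [xr l E]]]; last first.
  exists (s x), (s y); split; first exact/reach_symmetry.
    exact/lifts_symmetry.
  by rewrite /= E s_segment.
have [k sk ks] := s_bij; rewrite -(ks x) -(ks y) in xr l E.
exists (k x), (k y); split; first exact/reach_symmetry.
  exact/lifts_symmetry.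
by apply: (bij_inj (image_bijective s_bij)); rewrite s_segment.
Qed.

Lemma image_freach f x : s @` [set y | reach (fstep f) x y] =
  [set y | reach (fstep (on_face phi f)) (s x) y].
Proof.
have stepP := clos_rt_bij s_bij (fstep_symmetry f).
apply/seteqP; split=> [_ [y xy <-]|y xy]; first exact/stepP.
have [k sk ks] := s_bij; exists (k y); last exact: ks.
by apply/stepP; rewrite ks.
Qed.

Lemma lface_symmetry fK :
  (exists x v, [/\ reach step x0 x, pi x = rvert PL v, fverts (s_face fK).1 v &
     (s_face fK).2 = [set y | reach (fstep (s_face fK).1) x y]]) <->
  (exists x v, [/\ reach step x0 x, pi x = rvert PL v, fverts fK.1 v &
     fK.2 = [set y | reach (fstep fK.1) x y]]).
Proof.
split=> -[x [v [xr xv fv E]]]; last first.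
  exists (s x), (on_vert phi v); split; first exact/reach_symmetry.
  - exact/vertex_symmetry.
  - exact/on_fverts.
  - by rewrite /= E image_freach.
have [k sk ks] := s_bij; have [k' vk kv] := on_vert_bij phi.
rewrite -(ks x) -(kv v) in xr xv fv E.
exists (k x), (k' v); split; first exact/reach_symmetry.
- exact/vertex_symmetry.
- by apply/(on_fverts phi).
- by apply: (bij_inj (image_bijective s_bij)); rewrite image_freach.
Qed.

Let on_lvert := sub_map reach_symmetry.
Let on_ledge := sub_map larc_symmetry.
Let on_lface := sub_map lface_symmetry.

Lemma on_ledge_bij : bijective on_ledge.
Proof.
apply: (sub_map_bijective larc_symmetry).
exact: prod_bijective (on_edge_bij phi) (image_bijective s_bij).
Qed.

Lemma on_lface_bij : bijective on_lface.
Proof.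
apply: (sub_map_bijective lface_symmetry).
exact: prod_bijective (on_face_bij phi) (image_bijective s_bij).
Qed.

Lemma on_lends a X : ends (on_ledge a : arc lifted) (on_lvert X : node lifted) <-> ends a X.
Proof. by apply: image_inj_mem; exact: bij_inj. Qed.

Lemma on_lfverts g X : fverts (on_lface g : face lifted) (on_lvert X : node lifted) <-> fverts g X.
Proof. by apply: image_inj_mem; exact: bij_inj. Qed.

Lemma on_lfedges g a : fedges (on_lface g : face lifted) (on_ledge a : arc lifted) <-> fedges g a.
Proof.
have [X [Y [_ aX _ _ _]]] := larc_ends regPL x0v0 a.
have aX' : ends (on_ledge a : arc lifted) (on_lvert X : node lifted) by apply/on_lends.
rewrite (lfedges_at regPL x0v0 _ aX) (lfedges_at regPL x0v0 _ aX') on_lfverts.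
by rewrite /= on_fedges.
Qed.

Definition lifted_automorphism : automorphism lifted :=
  @Automorphism lifted on_lvert on_ledge on_lface
    (sub_map_bijective reach_symmetry s_bij) on_ledge_bij on_lface_bij
    on_lends on_lfverts on_lfedges.

Lemma lifted_automorphism_induced : induced_by lifted_automorphism s.
Proof.
split=> // g; apply/seteqP; split=> [_ [a ga <-]|_ [_ [a ga <-] <-]].
  have [k ek ke] := on_edge_bij lifted_automorphism; rewrite -(ke a) in ga *.
  exists (redge lifted (k a)) => //; exists (k a) => //; exact/on_fedges/ga.
by exists (on_edge lifted_automorphism a) => //; apply/on_fedges.
Qed.

End Symmetry.

(** Flags of [lifted] cover flags of the torus polyhedron. An isometry that moves one
of these to the other is lifted so as to move [X] to [X']; edges and faces follow
because they are determined by the vertex and by what they cover. *)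
Lemma lifted_flag_symmetry X a g X' a' g' :
  is_flag X a g -> is_flag X' a' g' ->
  exists2 psi : automorphism lifted,
    [/\ on_vert psi X = X', on_edge psi a = a' & on_face psi g = g'] &
    exists2 s, isometry (@edist R) s & induced_by psi s.
Proof.
move=> [aX ga gX] [aX' ga' gX'].
have [v Xv] := lnode_vertex x0v0 X; have [v' Xv'] := lnode_vertex x0v0 X'.
have flagv Y b h w : ends b Y -> fedges h b -> fverts h Y -> pi (sval Y) = rvert PL w ->
    is_flag w (sval b).1 (sval h).1.
  move=> bY [hb _] hY Yw; split=> //; first exact: (larc_over regPL x0v0) bY Yw.
  exact: (lface_over regPL) hY Yw.
have [[_ trans] _ _ _ symm] := regPL.
have [phi [phiv phie phif]] :=
  trans _ _ _ _ _ _ (flagv _ _ _ _ aX ga gX Xv) (flagv _ _ _ _ aX' ga' gX' Xv').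
have [t t_iso t_phi] := symm phi; have [tv _ _] := t_phi.
have [|s [s_iso sX s_proj s_seg]] := @lift_isometry R L t (sval X) (sval X') t_iso.
  by rewrite Xv Xv' -tv phiv.
exists (lifted_automorphism t_iso.1 t_phi s_iso.1 s_proj s_seg sX); last first.
  by exists s => //; apply: lifted_automorphism_induced.
set psi := lifted_automorphism _ _ _ _ _ _.
have psiX : on_vert psi X = X' by apply: sval_inj.
have psi_aX : ends (on_edge psi a) X' by rewrite -psiX; apply/on_ends.
have psi_gX : fverts (on_face psi g) X' by rewrite -psiX; apply/on_fverts.
split=> //; first exact: (larc_inj regPL x0v0 psi_aX aX' phie).
exact: (lface_inj psi_gX gX' phif).
Qed.

(** An automorphism coincides with the one given by [lifted_flag_symmetry] for the
image of a flag, by rigidity; it is therefore induced by an isometry. *)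
Lemma lifted_regular_in_E3 : regular_in_E3 lifted.
Proof.
have polyP := lifted_polyhedron regPL x0v0.
split.
- split=> // X a g X' a' g' fl fl'.
  by have [psi ? _] := lifted_flag_symmetry fl fl'; exists psi.
- exact: lifted_faithful.
- exact: lifted_discrete.
- by move=> a X Y; exact: lifted_segments.
- move=> phi; have [X [a [g fl]]] := flag_exists polyP.
  have fl' : is_flag (on_vert phi X) (on_edge phi a) (on_face phi g).
    by case: fl => *; split; [apply/on_ends | apply/on_fedges | apply/on_fverts].
  have [psi [pX pa pg] [s s_iso [sv se sf]]] := lifted_flag_symmetry fl fl'.
  have [ev ee ef] := automorphism_rigid polyP fl pX pa pg.
  by exists s => //; split; rewrite -?ev -?ee -?ef.
Qed.

End LiftedSymmetry.

Theorem theorem4p13 (R : realType) (L : lattice R) (PL : realized (torus L)) :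
  regular_in_torus PL ->
  exists P : realized (E3 R), regular_in_E3 P /\ projects_onto P PL.
Proof.
move=> regPL; have [[v0 _] _] := skel_connected (PL_polyhedron regPL).
have [x0 x0v0] := proj_surj (rvert PL v0).
exists (lifted PL x0); split; first exact: lifted_regular_in_E3 x0v0.
exact: lifted_projects_onto x0v0.
Qed.
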